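(* Let $M$ be a compact smooth Riemannian manifold, $f\in C^0(M)$, and let $G$ be a set of $C^1$ maps $M\to M$ such that $h^G_{\mathrm{loc}}(\varepsilon):=\sup_{g\in G}h_{\mathrm{loc}}(g,\varepsilon)$ goes to zero when $\varepsilon$ goes to zero and $$M_0(G):=\sup_{g\in G}\max(\|Dg\|_\infty,2)<\infty.$$ For $\varepsilon>0$ let $p_\varepsilon$ be the least positive integer satisfying $$\frac{1}{p_\varepsilon}\log r_{p_\varepsilon}(f,\varepsilon/4)-h(f,\varepsilon/4)\le h^G_{\mathrm{loc}}(\varepsilon),$$ and let $N$ denote the inverse function of $\varepsilon\mapsto\frac{\varepsilon}{4}M_0(G)^{-p_\varepsilon}$, i.e. $N(\varepsilon)$ is the smallest positive real number such that $\frac{N(\varepsilon)}{4}M_0(G)^{-p_{N(\varepsilon)}}=\varepsilon$. Then for any $\varepsilon>0$ (for which $N(\varepsilon)$ is defined) and any $g\in G$ with $d(g,f):=\sup_{x\in M}d(gx,fx)\le\varepsilon$, $$h(g)\le h(f)+2h^G_{\mathrm{loc}}(N(\varepsilon)).$$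
   Context: $C^0(M)$ is the set of continuous maps $M\to M$; $d$ is the Riemannian distance. For $\Lambda\subset M$, $\delta>0$, $r_n(f,\Lambda,\delta)$ is the smallest cardinality of a set $K\subset M$ such that for every $x\in\Lambda$ there is $y\in K$ with $d(f^ix,f^iy)<\delta$ for $0\le i\le n-1$; $r_n(f,\delta)=r_n(f,M,\delta)$. $h(f,\varepsilon)=\limsup_n\frac1n\log r_n(f,\varepsilon)$ and $h(f)=\lim_{\varepsilon\to0}h(f,\varepsilon)$ is the topological entropy. $B_n(f,x,\varepsilon)=\{y: d(f^iy,f^ix)<\varepsilon,\ 0\le i\le n-1\}$. For an $f$-invariant Borel probability measure $\mu$, $$h_{\mathrm{loc}}(\mu,\varepsilon)=\lim_{\sigma\to1,\ \sigma<1}\ \inf_{F:\ \mu(F)\ge\sigma}\ \lim_{\delta\to0}\limsup_{n\to\infty}\frac1n\log\sup_{x\in F}r_n(f,F\cap B_n(f,x,\varepsilon),\delta),$$ the infimum being over Borel sets $F$, and $h_{\mathrm{loc}}(f,\varepsilon)=\sup_\mu h_{\mathrm{loc}}(\mu,\varepsilon)$ over all $f$-invariant Borel probability measures. *)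

(* Defs.v *)
From HB Require Import structures.
From mathcomp Require Import all_boot all_order all_algebra.
From mathcomp Require Import all_classical all_reals all_analysis.
Set Implicit Arguments.
Unset Strict Implicit.
Unset Printing Implicit Defensive.
Import Order.TTheory GRing.Theory Num.Theory.
Import numFieldNormedType.Exports.
Local Open Scope classical_set_scope.
Local Open Scope ring_scope.

(* [f] is of class C^k on the set [U], which is meant to be open; the values of
   [f] outside [U] are irrelevant. *)
Fixpoint Ck_on (R : realType) (V W : normedModType R) (k : nat) (U : set V)
    (f : V -> W) : Prop :=
  match k with
  | 0%N => forall x, U x -> {for x, continuous f}
  | k'.+1 => (forall x, U x -> differentiable f x) /\
             (forall v : V, Ck_on k' U ('D_v f))
  end.

Definition smooth_on (R : realType) (V W : normedModType R) (U : set V)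
    (f : V -> W) : Prop := forall k, Ck_on k U f.

(* A smooth [n]-dimensional Riemannian manifold (Hausdorff, without boundary):
   an atlas of charts [phi i], defined on [dom i] with inverse [psi i], and in
   each chart the Gram matrix [gram i] of the metric as a function of the
   coordinates. The preferred chart [chart_at x] around [x] serves to identify
   the tangent space at [x] with R^n. Second countability is not required: it
   follows from compactness, which is a hypothesis wherever it is needed. *)
Record riemannianManifold (R : realType) (M : ptopologicalType) (n : nat) :=
  RiemannianManifold {
  hausdorffM : hausdorff_space M ;
  chart : Type ;
  dom : chart -> set M ;
  phi : chart -> M -> 'rV[R]_n ;
  psi : chart -> 'rV[R]_n -> M ;
  chart_at : M -> chart ;
  chart_atP : forall x, dom (chart_at x) x ;
  open_dom : forall i, open (dom i) ;
  open_codom : forall i, open (phi i @` dom i) ;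
  phiK : forall i x, dom i x -> psi i (phi i x) = x ;
  phi_continuous : forall i x, dom i x -> {for x, continuous (phi i)} ;
  psi_continuous : forall i u, (phi i @` dom i) u -> {for u, continuous (psi i)} ;
  transition_smooth : forall i j,
    smooth_on (phi i @` (dom i `&` dom j)) (phi j \o psi i) ;
  gram : chart -> 'rV[R]_n -> 'M[R]_n ;
  gram_smooth : forall i, smooth_on (phi i @` dom i) (gram i) ;
  gram_sym : forall i u, (phi i @` dom i) u -> (gram i u)^T = gram i u ;
  gram_pos : forall i u (v : 'rV[R]_n), (phi i @` dom i) u -> v != 0 ->
    0 < (v *m gram i u *m v^T) 0 0 ;
  gram_compat : forall i j x (v w : 'rV[R]_n), dom i x -> dom j x ->
    v *m gram i (phi i x) *m w^T =
    'D_v (phi j \o psi i) (phi i x) *m gram j (phi j x)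
      *m ('D_w (phi j \o psi i) (phi i x))^T }.

Section RiemannianGeometry.
Context {R : realType} {M : ptopologicalType} {n : nat}.
Variable A : riemannianManifold R M n.

(* Norm of the tangent vector at [x] with coordinates [v] in [chart_at A x]. *)
Definition tnorm (x : M) (v : 'rV[R]_n) : R :=
  Num.sqrt ((v *m gram (chart_at A x) (phi (chart_at A x) x) *m v^T) 0 0).

Definition C1_map (g : M -> M) : Prop :=
  continuous g /\
  forall i j : chart A, Ck_on 1 (phi i @` (dom i `&` g @^-1` dom j))
    (phi j \o g \o psi i).

(* The tangent map of [g] at [x], in the charts preferred at [x] and [g x]. *)
Definition tmap (g : M -> M) (x : M) (v : 'rV[R]_n) : 'rV[R]_n :=
  'D_v (phi (chart_at A (g x)) \o g \o psi (chart_at A x))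
       (phi (chart_at A x) x).

Definition normD (g : M -> M) : \bar R :=
  ereal_sup [set (tnorm (g p.1) (tmap g p.1 p.2))%:E |
             p in [set p : M * 'rV[R]_n | tnorm p.1 p.2 <= 1]].

Definition C1_curve_on (U : set R) (c : R -> M) : Prop :=
  (forall t, U t -> {for t, continuous c}) /\
  forall i : chart A, @Ck_on R R^o _ 1 (U `&` c @^-1` dom i) (phi i \o c).

(* Each piece is C^1 up to the endpoints: it extends to a C^1 curve on a
   neighbourhood of the closed subinterval. *)
Definition pw_C1_curve (c : R -> M) : Prop :=
  exists s : seq R, itv_partition 0 1 s /\
  forall i, (i < size s)%N -> exists (U : set R) (c' : R -> M),
    [/\ open U, `[nth 0 (0 :: s) i, nth 0 (0 :: s) i.+1] `<=` U,
        C1_curve_on U c' &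
        forall t, t \in `[nth 0 (0 :: s) i, nth 0 (0 :: s) i.+1] -> c t = c' t].

Definition speed (c : R -> M) (t : R) : R :=
  tnorm (c t) (derive1 (phi (chart_at A (c t)) \o c) t).

Definition curve_length (c : R -> M) : \bar R :=
  (\int[@lebesgue_measure R]_(t in `[0%R, 1%R]) (speed c t)%:E)%E.

(* Riemannian distance; [+oo] between distinct connected components. *)
Definition rdist (x y : M) : \bar R :=
  ereal_inf [set curve_length c |
             c in [set c | [/\ pw_C1_curve c, c 0 = x & c 1 = y]]].

Definition map_dist (g f : M -> M) : \bar R :=
  ereal_sup [set rdist (g x) (f x) | x in [set: M]].

Definition dyn_close (n0 : nat) (f : M -> M) (e : R) (x y : M) : Prop :=
  forall i, (i < n0)%N -> (rdist (iter i f x) (iter i f y) < e%:E)%E.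

(* The minimal cardinality of a spanning set, [+oo] if there is no finite one;
   the centres are arbitrary points of [M]. *)
Definition rspan (k : nat) (f : M -> M) (L : set M) (delta : R) : \bar R :=
  ereal_inf [set (m%:R : R)%:E | m in [set m : nat | exists K : set M,
    (K #= `I_m)%card /\
    forall x, L x -> exists2 y, K y & dyn_close k f delta x y]].

Definition dyn_ball (k : nat) (f : M -> M) (x : M) (e : R) : set M :=
  [set y | dyn_close k f e y x].

Definition entropy_at (f : M -> M) (e : R) : \bar R :=
  limn_esup (fun k : nat => ((k%:R^-1)%:E * lne (rspan k f [set: M] e))%E).

Definition entropy (f : M -> M) : \bar R :=
  lim (entropy_at f e @[e --> 0^'+]).

Local Notation borelM := (g_sigma_algebraType (@open M)).

Definition invariant_measure (f : M -> M) (mu : probability borelM R) : Prop :=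
  forall B : set borelM, measurable B -> mu (f @^-1` B) = mu B.

Definition hloc_set (f : M -> M) (F : set M) (e : R) : \bar R :=
  lim (limn_esup (fun k : nat => ((k%:R^-1)%:E *
         lne (ereal_sup [set rspan k f (F `&` dyn_ball k f x e) delta
                        | x in F]))%E) @[delta --> 0^'+]).

Definition hloc_measure (f : M -> M) (mu : probability borelM R) (e : R)
    : \bar R :=
  lim (ereal_inf [set hloc_set f F e |
         F in [set F : set borelM | measurable F /\ (sigma%:E <= mu F)%E]]
       @[sigma --> (1 : R)^'-]).

Definition hloc (f : M -> M) (e : R) : \bar R :=
  ereal_sup [set hloc_measure f mu e | mu in invariant_measure f].

Definition hlocG (G : set (M -> M)) (e : R) : \bar R :=
  ereal_sup [set hloc g e | g in G].

Definition M0 (G : set (M -> M)) : \bar R :=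
  ereal_sup [set maxe (normD g) 2%:E | g in G].

Definition p_cond (f : M -> M) (G : set (M -> M)) (e : R) (p : nat) : Prop :=
  (0 < p)%N /\
  ((p%:R^-1)%:E * lne (rspan p f [set: M] (e / 4)) - entropy_at f (e / 4)
     <= hlocG G e)%E.

(* [p] is p_e. This is a relation because p_e need not exist when
   h_loc^G(e) = 0. *)
Definition is_p (f : M -> M) (G : set (M -> M)) (e : R) (p : nat) : Prop :=
  p_cond f G e p /\ forall q, p_cond f G e q -> (p <= q)%N.

Definition N_cond (f : M -> M) (G : set (M -> M)) (e eta : R) : Prop :=
  0 < eta /\ exists2 p, is_p f G eta p & eta / 4 * fine (M0 G) ^- p = e.

(* N(e) is defined and equal to [eta]. *)
Definition is_N (f : M -> M) (G : set (M -> M)) (e eta : R) : Prop :=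
  N_cond f G e eta /\ forall t, N_cond f G e t -> eta <= t.

End RiemannianGeometry.

(* Main.v *)
From HB Require Import structures.
Require Import Defs.
From mathcomp Require Import all_boot all_order all_algebra.
From mathcomp Require Import all_classical all_reals all_analysis.
From mathcomp Require Import measurable_realfun.
From mathcomp Require Import finmap ring lra zify.

(** Write [p] for p_eta and [a] for (1/p) log r_p(f, eta/4). The norms of the
    derivatives bound the Lipschitz constant of [g] by M0 >= 2, so the orbits of
    a point under [f] and [g] stay at distance at most M0^p eps = eta/4 during
    [p] steps. Two points that follow the same centre of a minimal
    (p, eta/4)-spanning set of [f] are then (p, eta)-close for [g]
    ([dyn_close_transfer]). Hence the r_p(f, eta/4) centres code the points of
    [M] in such a way that points with the same code are (p, eta)-close for [g],
    and the theorem follows from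
      h(g) <= a + h_loc(g, eta)     ([entropy_le_code_local])
    because the choice of [p] gives a <= h(f, eta/4) + h_loc^G(eta).

    The inequality compares a topological quantity with one defined through
    invariant measures. Suppose that h(g, delta) > c > a + h_loc(g, eta). For
    infinitely many k there is a (k, delta)-separated set of more than exp(c k)
    points. Let nu_k be the average of the Dirac masses along the orbit segments
    of length k of its points, and let m be the limit of the nu_k along an
    ultrafilter: a finitely additive, [g]-invariant probability defined on all
    subsets of [M]. Its values on closed sets generate a regular Borel
    probability mu, which is [g]-invariant and satisfies mu(U) <= m(U) for every
    open U ([regular_measure], [regular_measure_invariant],
    [separated_orbits_measure]).

    By definition of h_loc there is a Borel set F with mu(F) close to 1 on which
    the local growth at scale eta is less than H, for some H < c - a. For a large
    q the set F is covered by roughly exp(q (a + H)) open (q, delta/2)-balls: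
    q/p successive codes determine a point of F up to a ball B_q(x, eta), and the
    part of F in this ball is spanned by exp(q H) points ([local_spans_code]).
    The union U of these N balls is open, so m(U) >= mu(F) and nu_k(U) is close
    to 1 for arbitrarily large k. At least half of the separated points therefore
    spend only a small number b of times outside U. Cut their orbits greedily
    into blocks of length q that start in U, each of them described by one of N
    balls, and single steps that start outside U, each of them described by one
    of r cells of diameter less than delta. As points with the same description
    are (k, delta)-close, there are at most (2N)^(k/q+1) (2r)^b of them
    ([card_separated]), which is less than exp(c k)/2 for large k.

    The argument uses four properties of the Riemannian distance, obtained from
    the length functional: it is a symmetric function that satisfies the triangle
    inequality ([rdist_sym], [rdist_triangle]), it is small near the diagonal
    ([rdist_near]), and C1 maps are Lipschitz for it ([rdist_map]). *)

Set Implicit Arguments.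
Unset Strict Implicit.
Unset Printing Implicit Defensive.
Import Order.TTheory GRing.Theory Num.Theory.
Import numFieldNormedType.Exports.
Local Open Scope classical_set_scope.
Local Open Scope ring_scope.

(** * Counting separated orbit segments *)

Lemma leq_card_fibers (I T : finType) (E : {set I}) (f : I -> T) (m : nat) :
  (forall j, (#|[set s in E | f s == j]| <= m)%N) -> (#|E| <= #|T| * m)%N.
Proof.
move=> H; rewrite -sum1_card (partition_big f predT)//=.
rewrite -sum_nat_const; apply: leq_sum => j _.
by apply: leq_trans (H j); rewrite -sum1_card leq_eqVlt; apply/orP; left;
  apply/eqP/eq_bigl => s; rewrite inE.
Qed.

Section Counting.
Local Open Scope nat_scope.
Variables (X : Type) (g : X -> X) (D : X -> X -> Prop) (q : nat).
Variables (T1 T2 : finType) (U : set X) (beta : X -> T1) (alpha : X -> T2).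
Hypothesis q0 : (0 < q)%N.
Hypothesis betaP : forall x y, U x -> U y -> beta x = beta y ->
  forall i, (i < q)%N -> D (iter i g x) (iter i g y).
Hypothesis alphaP : forall x y, alpha x = alpha y -> D x y.

Definition visits (V : set X) n x := (\sum_(0 <= i < n) `[<V (iter i g x)>])%N.

(** Induction on the length [n] of the orbit segments. The points of [E] in [U]
    are split according to [beta]: within a class the first [q] steps do not
    separate the points, so their images under [g^q] are still separated, over a
    length shorter by [q]. The points outside [U] are split according to [alpha]
    and moved by one step, which uses up one of the [b] visits outside [U]. The
    two factors 2 pay for the sum of the two contributions. *)
Lemma card_separated n K b (I : finType) (E : {set I}) (pt : I -> X) :
  (n <= K * q)%N ->
  {in E &, forall s t, (forall i, (i < n)%N -> D (iter i g (pt s)) (iter i g (pt t))) -> s = t} ->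
  {in E, forall s, (visits (~` U) n (pt s) <= b)%N} ->
  (#|E| <= (2 * #|T1|) ^ K * (2 * #|T2|) ^ b)%N.
Proof.
elim/ltn_ind: n K b E pt => n IH K b E pt nK sepE badE.
have [->|[s0 s0E]] := set_0Vmem E; first by rewrite cards0.
have T1_gt0 : (0 < #|T1|)%N by apply/card_gt0P; exists (beta (pt s0)).
have T2_gt0 : (0 < #|T2|)%N by apply/card_gt0P; exists (alpha (pt s0)).
case: (posnP n) => [n0|n0].
  apply: (@leq_trans 1%N); last by rewrite muln_gt0 !expn_gt0 !muln_gt0 T1_gt0 T2_gt0.
  rewrite (cardD1 s0) s0E -[X in (_ <= X)%N]addn0 leq_add2l leqn0; apply/eqP/eq_card0 => t.
  rewrite !inE; apply/negbTE; rewrite negb_and negbK orbC -implybE; apply/implyP => tE.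
  by apply/eqP; apply: sepE => // i; rewrite n0.
have K0 : (0 < K)%N by case: K nK => //; rewrite mul0n leqNgt n0.
pose EU := [set s in E | `[<U (pt s)>]]; pose EV := E :\: EU.
rewrite -(cardsID EU E) (finset.setIidPr _); last first.
  by apply/fintype.subsetP => s; rewrite !inE => /andP[].
have bU : (#|EU| <= #|T1| * ((2 * #|T1|) ^ K.-1 * (2 * #|T2|) ^ b))%N.
  apply: (@leq_card_fibers _ _ _ (beta \o pt)) => j.
  apply: (IH (n - q)%N _ K.-1 b _ (iter q g \o pt)).
  - by rewrite ltn_subrL q0 n0.
  - by rewrite leq_subLR -mulSn prednK.
  - move=> s t; rewrite !inE /= => /andP[/andP[sE /asboolP Us] /eqP sj].
    move=> /andP[/andP[tE /asboolP Ut] /eqP tj] H.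
    apply: sepE => // i ltn_i; have [iq|qi] := ltnP i q.
      by apply: betaP => //; rewrite sj.
    by rewrite -(subnK qi) !iterD; apply: H; rewrite ltn_sub2r// (leq_ltn_trans qi).
  - move=> s; rewrite !inE => /andP[/andP[sE _] _]; apply: leq_trans (badE s sE).
    rewrite /visits; have [qn|/ltnW nq] := leqP q n; last first.
      by have /eqP -> : (n - q == 0)%N; [rewrite subn_eq0|rewrite big_geq].
    rewrite [leqRHS](big_cat_nat (leq0n q) qn) /= -[X in (X <= _)%N]add0n leq_add//.
    rewrite -[X in (_ <= \sum_(X <= _ < _) _)%N](add0n q) big_addn; apply: leq_sum => i _.
    by rewrite iterD.
have bV : (#|EV| <= #|T2| * ((2 * #|T1|) ^ K * (2 * #|T2|) ^ b.-1))%N.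
  have EVP s : s \in EV -> [/\ s \in E, ~ U (pt s) &
     (visits (~` U) n.-1 (g (pt s)) <= b.-1)%N /\ (0 < b)%N].
    rewrite !inE => /andP[+ sE]; rewrite sE/= => /asboolP nU; split=> //.
    have := badE s sE; rewrite /visits -{1}(prednK n0) big_nat_recl//=.
    rewrite (_ : `[< (~` U) (pt s) >] = true); last exact/asboolP.
    rewrite add1n => lt_b; have b0 : (0 < b)%N by exact: leq_ltn_trans lt_b.
    split=> //; rewrite -ltnS (prednK b0); apply: leq_ltn_trans lt_b.
    by apply: leq_sum => i _; rewrite -iterS iterSr.
  apply: (@leq_card_fibers _ _ _ (alpha \o pt)) => j.
  apply: (IH n.-1 _ K b.-1 _ (g \o pt)).
  - by rewrite prednK.
  - exact: leq_trans (leq_pred n) nK.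
  - move=> s t; rewrite !inE /= => /andP[/andP[_ sE] /eqP sj].
    move=> /andP[/andP[_ tE] /eqP tj] H.
    apply: sepE => // -[_|i ltn_i] /=; first by apply: alphaP; rewrite sj.
    by rewrite -!iterS !iterSr; apply: H; rewrite -ltnS prednK.
  - by move=> s; rewrite inE => /andP[/EVP[_ _ []]].
have [EV0|[s1 s1V]] := set_0Vmem EV.
  rewrite -/EV EV0 cards0 addn0; apply: (leq_trans bU).
  rewrite mulnA leq_mul2r; apply/orP; right.
  by rewrite -{2}(prednK K0) expnS leq_mul2r leq_pmull// orbT.
have b0 : (0 < b)%N.
  move: s1V; rewrite !inE => /andP[+ s1E]; rewrite s1E /= => /asboolP nU.
  apply: leq_trans (badE _ s1E); rewrite /visits -{1}(prednK n0) big_nat_recl//=.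
  by rewrite (_ : `[< (~` U) (pt s1) >] = true)//; apply/asboolP.
apply: (leq_trans (leq_add bU bV)).
have -> : ((2 * #|T1|) ^ K = 2 * (#|T1| * (2 * #|T1|) ^ K.-1))%N.
  by rewrite -{1}(prednK K0) expnS mulnA.
have -> : ((2 * #|T2|) ^ b = 2 * (#|T2| * (2 * #|T2|) ^ b.-1))%N.
  by rewrite -{1}(prednK b0) expnS mulnA.
rewrite leq_eqVlt; apply/orP; left; apply/eqP.
move: (_ ^ _)%N (_ ^ _)%N => p s; ring.
Qed.
End Counting.

(** * From finitely additive probabilities to regular measures *)

(** A finitely additive probability defined on all subsets: limits of measures
    along an ultrafilter are of this kind. *)
Record fin_add_prob (R : realType) (T : Type) := FinAddProb {
  fa_val :> set T -> R;
  fa_ge0 : forall B, 0 <= fa_val B;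
  fa_setT : fa_val setT = 1;
  fa_setU : forall B C, B `&` C = set0 -> fa_val (B `|` C) = fa_val B + fa_val C }.

Section FinitelyAdditive.
Context {R : realType} {T : Type}.
Variable m : fin_add_prob R T.
Implicit Types (B C : set T).

Lemma fa_le B C : B `<=` C -> (m B <= m C)%R.
Proof.
move=> BC; rewrite -(setDUK BC) fa_setU ?setDIK//.
by rewrite lerDl fa_ge0.
Qed.

Lemma fa0 : m set0 = 0%R.
Proof.
have := @fa_setU _ _ m set0 set0 (setI0 _); rewrite setU0.
by move/(congr1 (fun x => x - m set0))%R; rewrite subrr addrK => <-.
Qed.

Lemma fa_subU B C : (m (B `|` C) <= m B + m C)%R.
Proof.
rewrite -(setDUK (@subsetUl _ B C)) fa_setU ?setDIK// lerD2l; apply: fa_le.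
by move=> x [[//|Cx]].
Qed.

Lemma fa_le1 B : (m B <= 1)%R.
Proof. by rewrite -(fa_setT m) fa_le. Qed.

End FinitelyAdditive.

Section OuterContent.
Context {R : realType} {T : ptopologicalType}.
Hypothesis (hausT : hausdorff_space T) (compT : compact [set: T]).
Variable m : fin_add_prob R T.
Implicit Types (B C K L U V : set T).
Local Open Scope ereal_scope.

(** The content of an open set, taken from closed subsets only: [m] itself is
    not countably additive, and compactness of closed sets is what turns finite
    subadditivity into countable subadditivity. *)
Definition inner_content U : \bar R := ereal_sup [set (m K)%:E | K in [set K | closed K /\ K `<=` U]].
Definition outer_content B : \bar R := ereal_inf [set inner_content U | U in [set U | open U /\ B `<=` U]].

Lemma inner_ge K U : closed K -> K `<=` U -> (m K)%:E <= inner_content U.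
Proof. by move=> cK KU; apply: ereal_sup_ubound; exists K. Qed.

Lemma inner_le U (x : \bar R) : (forall K, closed K -> K `<=` U -> (m K)%:E <= x) -> inner_content U <= x.
Proof. by move=> H; apply: ge_ereal_sup => _ [K [cK KU] <-]; exact: H. Qed.

Lemma inner_le_fa U : inner_content U <= (m U)%:E.
Proof. by apply: inner_le => K _ KU; rewrite lee_fin fa_le. Qed.

Lemma inner_ge0 U : 0 <= inner_content U.
Proof. by apply: le_trans (inner_ge closed0 (@sub0set _ U)); rewrite fa0. Qed.

Lemma inner_fin U : inner_content U \is a fin_num.
Proof.
rewrite ge0_fin_numE ?inner_ge0//; apply: le_lt_trans (ltry 1).
by apply: (le_trans (inner_le_fa U)); rewrite lee_fin fa_le1.
Qed.

Lemma inner_mono U V : U `<=` V -> inner_content U <= inner_content V.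
Proof. by move=> UV; apply: inner_le => K cK KU; apply: inner_ge => // x /KU/UV. Qed.

Lemma outer_le B U : open U -> B `<=` U -> outer_content B <= inner_content U.
Proof. by move=> oU BU; apply: ereal_inf_lbound; exists U. Qed.

Lemma outer_ge B (x : \bar R) : (forall U, open U -> B `<=` U -> x <= inner_content U) -> x <= outer_content B.
Proof. by move=> H; apply/ereal_infP => _ [U [oU BU] <-]; exact: H. Qed.

Lemma outer_open U : open U -> outer_content U = inner_content U.
Proof.
move=> oU; apply/eqP; rewrite eq_le outer_le//=.
by apply: outer_ge => V _; exact: inner_mono.
Qed.

Lemma outer_mono B C : B `<=` C -> outer_content B <= outer_content C.
Proof. by move=> BC; apply: outer_ge => U oU CU; apply: outer_le => // x /BC/CU. Qed.

Lemma outer_nonneg B : 0 <= outer_content B.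
Proof. by apply: outer_ge => U _ _; exact: inner_ge0. Qed.

Lemma outer_empty : outer_content set0 = 0.
Proof.
rewrite outer_open; last exact: open0.
by apply/eqP; rewrite eq_le inner_ge0 andbT (le_trans (inner_le_fa _))// fa0.
Qed.

Lemma outer_fin B : outer_content B \is a fin_num.
Proof.
rewrite ge0_fin_numE ?outer_nonneg//.
apply: (@le_lt_trans _ _ (inner_content setT)); first by apply: outer_le => //; exact: openT.
by rewrite ltey_eq inner_fin.
Qed.

(** By normality a closed subset of [U1 `|` U2] is the union of a closed subset
    of [U1] and a closed subset of [U2]. *)
Lemma inner_finite_subadd N (U : nat -> set T) K : (forall i, open (U i)) ->
  closed K -> K `<=` \big[setU/set0]_(i < N) U i ->
  (m K)%:E <= \sum_(i < N) inner_content (U i).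
Proof.
move=> oU; elim: N K => [|N IH] K cK.
  by rewrite !big_ord0 subset0 => ->; rewrite fa0.
rewrite !big_ord_recr /=; set V := \big[_/_]_(_ < _) _ => KV.
have oV : open V by rewrite /V; elim/big_ind: _ => // [|? ? ? ?]; [exact: open0|exact: openU].
have cKV : closed (K `\` V) by apply: closedI => //; exact: open_closedC.
have cKU : closed (K `\` U N) by apply: closedI => //; exact: open_closedC.
have dis : (K `\` V) `&` (K `\` U N) = set0.
  by rewrite -subset0 => x [[Kx nV] [_ nU]]; case: (KV _ Kx).
have [W1 [W2 [oW1 oW2 s1 s2 d12]]] :=
  (normal_openP (R:=R)).1 (compact_normal hausT compT) _ _ cKV cKU dis.
have cK1 : closed (K `\` W1) by apply: closedI => //; exact: open_closedC.
have cK2 : closed (K `\` W2) by apply: closedI => //; exact: open_closedC.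
have sub : K `<=` (K `\` W1) `|` (K `\` W2).
  move=> x Kx; have [w1|] := pselect (W1 x); last by left.
  by right; split=> // w2; have W12 : (W1 `&` W2) x by []; rewrite d12 in W12.
apply: (@le_trans _ _ ((m (K `\` W1))%:E + (m (K `\` W2))%:E)).
  by rewrite -EFinD lee_fin (le_trans (fa_le m sub))// fa_subU.
apply: leeD.
  by apply: IH => // x [Kx nW]; apply: contrapT => nV; apply: nW; exact: s1.
by apply: inner_ge => // x [Kx nW]; apply: contrapT => nV; apply: nW; exact: s2.
Qed.

(** A closed subset of a union of open sets is compact, hence covered by finitely
    many of them. *)
Lemma inner_sigma_subadd (U : nat -> set T) : (forall i, open (U i)) ->
  inner_content (\bigcup_i U i) <= \sum_(i <oo) inner_content (U i).
Proof.
move=> oU; apply: inner_le => K cK KU.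
have : compact K by exact: subclosed_compact cK compT _.
rewrite compact_cover => /(_ nat setT U (fun i _ => oU i) KU)[D _ KD].
pose N := (\max_(i <- enum_fset D) i).+1.
have KN : K `<=` \big[setU/set0]_(i < N) U i.
  move=> x /KD[i /= iD Ux]; rewrite -bigcup_mkord; exists i => //=.
  rewrite ltnS; apply: (@leq_bigmax_seq _ (enum_fset D) predT id) => //; exact: iD.
apply: (le_trans (inner_finite_subadd oU cK KN)).
rewrite -(big_mkord xpredT (fun i => inner_content (U i))).
by apply: nneseries_lim_ge => k _ _; exact: inner_ge0.
Qed.

Lemma outer_sigma_subadd : sigma_subadditive outer_content.
Proof.
move=> F; apply/lee_addgt0Pr => e e0.
have ex i : exists U, [/\ open U, F i `<=` U & inner_content U <= outer_content (F i) + (e / (2 ^ i.+1)%:R)%:E].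
  have ei : (0 < e / (2 ^ i.+1)%:R)%R by rewrite divr_gt0// ltr0n expn_gt0.
  have [_ [U [oU FU] <-] /ltW le] := lb_ereal_inf_adherent ei (outer_fin (F i)).
  by exists U.
have [U HU] := choice ex.
have oU i : open (U i) by have [] := HU i.
have FU : \bigcup_i F i `<=` \bigcup_i U i.
  by move=> x [i _ Fx]; exists i => //; have [_ s _] := HU i; exact: s.
apply: (le_trans (outer_le (bigcup_open (fun i _ => oU i)) FU)).
apply: (le_trans (inner_sigma_subadd oU)).
apply: le_trans (epsilon_trick _ _ _) => //; last exact: ltW.
- apply: lee_nneseries => [i _ _|i _]; first exact: inner_ge0.
  by have [] := HU i.
- by move=> i; exact: outer_nonneg.
Qed.

(** If [V] is an open set that contains [B], a closed [K] in [V `&` U] and then a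
    closed [L] in [V `\` K] have total content at most that of [V]; taking [L]
    first and [K] next to their suprema bounds the two parts of [B]. *)
Lemma outer_caratheodory (mu : {outer_measure set T -> \bar R}) U :
  (forall B, mu B = outer_content B) -> open U -> caratheodory_measurable mu U.
Proof.
move=> muE oU; apply: le_caratheodory_measurable => B; rewrite !muE.
apply: outer_ge => V oV BV.
have : outer_content (B `&` U) <= inner_content (V `&` U).
  by apply: outer_le; [exact: openI|exact: setSI].
move=> /(leeD2r (outer_content (B `&` ~` U)))/le_trans; apply.
rewrite -leeBrDr ?outer_fin//; apply: inner_le => K cK KVU.
rewrite leeBrDr ?outer_fin//.
have oVK : open (V `\` K) by apply: openI => //; exact: closed_openC.
have : outer_content (B `&` ~` U) <= inner_content (V `\` K).
  by apply: outer_le => // x [/BV Vx nU]; split=> // /KVU[].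
move=> /(leeD2l (m K)%:E)/le_trans; apply.
rewrite addeC -leeBrDr//; apply: inner_le => L cL LVK.
rewrite leeBrDr// -EFinD -fa_setU; last first.
  by rewrite -subset0 => x [/LVK[_ nK] /nK].
apply: inner_ge; first exact: closedU.
by move=> x [/LVK[]|/KVU[]].
Qed.

End OuterContent.

Section RegularMeasure.
Context {R : realType} {T : ptopologicalType}.
Hypothesis (hausT : hausdorff_space T) (compT : compact [set: T]).
Variable m : fin_add_prob R T.
Local Open Scope ereal_scope.
Local Notation borelT := (g_sigma_algebraType (@open T)).

(** Open sets are measurable in the sense of Caratheodory for the outer measure
    defined by [m], which is therefore a measure on the Borel sets. *)
Lemma regular_measure : exists mu : probability borelT R,
  forall U : set T, open U -> mu U = inner_content m U.
Proof.
pose om : {outer_measure set T -> \bar R} := HB.pack (outer_content m)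
  (isOuterMeasure.Build R T (outer_content m) (outer_empty m) (outer_nonneg m)
    (fun B C => @outer_mono _ _ m B C) (@outer_sigma_subadd _ _ hausT compT m)).
have cara U : (<<s @open T >>) U -> caratheodory_measurable om U.
  apply: smallest_sub.
    exact: (@sigma_algebra_measurable _ (caratheodory_type om)).
  by move=> V oV; exact: outer_caratheodory.
have sadd : semi_sigma_additive (outer_content m : set borelT -> \bar R).
  move=> F mF tF mbF.
  apply: (@caratheodory_measure_sigma_additive R T om) => //.
  - by move=> i; apply: cara; exact: mF.
  - exact: cara.
pose mes := isMeasure.Build _ borelT R (outer_content m : set borelT -> \bar R)
  (outer_empty m) (outer_nonneg m) sadd.
pose mu0 : {measure set borelT -> \bar R} := HB.pack (outer_content m : set borelT -> \bar R) mes.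
have mu1 : mu0 setT = 1.
  rewrite /mu0/= outer_open; last exact: openT.
  apply/eqP; rewrite eq_le; apply/andP; split.
    by apply: (le_trans (inner_le_fa _ _)); rewrite fa_setT.
  by rewrite -(fa_setT m); apply: inner_ge => //; exact: closedT.
pose mu : probability borelT R := HB.pack (outer_content m : set borelT -> \bar R) mes
  (Measure_isProbability.Build _ borelT R mu0 mu1).
by exists mu => U oU; exact: outer_open.
Qed.

(** On an open [U] the inequality [mu (g @^-1` U) <= mu U] holds because [g]
    maps closed sets to closed sets by compactness, and the converse one follows by regularity
    and complementation. Open sets form a pi-system, so that equality extends to
    Borel sets. *)
Lemma regular_measure_invariant (mu : probability borelT R) (g : T -> T) :
  (forall U : set T, open U -> mu U = inner_content m U) ->
  continuous g -> (forall B : set T, m (g @^-1` B) = m B) ->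
  forall B : set borelT, measurable B -> mu (g @^-1` B) = mu B.
Proof.
move=> muE cg mg.
have mo (U : set T) : open U -> measurable (U : set borelT) by exact: sub_sigma_algebra.
have og (U : set T) : open U -> open (g @^-1` U) by move/continuousP: cg; exact.
have mgo (U : set T) : open U -> measurable (g @^-1` U : set borelT).
  by move=> oU; apply: mo; exact: og.
have mgf : measurable_fun setT (g : borelT -> borelT).
  apply: (@measurability _ _ borelT borelT _ _ (@open T)); first by [].
  by move=> _ [U oU <-]; rewrite setTI; apply: mo; exact: og.
have le1 (U : set T) : open U -> mu (g @^-1` U) <= mu U.
  move=> oU; rewrite !muE//; last exact: og.
  apply: inner_le => K cK KU.
  have cgK : compact (g @` K).
    apply: continuous_compact; first exact: continuous_subspaceT.
    exact: subclosed_compact cK compT _.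
  apply: (@le_trans _ _ (m (g @` K))%:E).
    by rewrite lee_fin -[leRHS]mg; apply: fa_le; exact: preimage_image.
  apply: inner_ge; first exact: compact_closed.
  by move=> _ [x /KU Ux <-].
have ge1 (U : set T) : open U -> mu U <= mu (g @^-1` U).
  move=> oU; rewrite muE//; apply: inner_le => K cK KU.
  have oKc : open (~` K) by exact: closed_openC.
  have mKc : m (~` K) = (1 - m K)%R.
    rewrite -(fa_setT m) -(setUCr K) fa_setU ?setICr//.
    by rewrite addrAC subrr add0r.
  apply: (@le_trans _ _ (mu (g @^-1` K))); last first.
    have mgK : measurable (g @^-1` K : set borelT).
      by rewrite -(setCK (g @^-1` K)); exact: (measurableC (mgo _ oKc)).
    by apply: le_measure; [exact/mem_set|apply/mem_set; exact: mgo|move=> x; exact: KU].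
  rewrite -(setCK (g @^-1` K)) -[~` (g @^-1` K)]/(g @^-1` (~` K)).
  rewrite probability_setC; last exact: mgo.
  rewrite leeBrDr; last by apply: fin_num_measure; exact: mgo.
  apply: (@le_trans _ _ ((m K)%:E + (m (~` K))%:E)).
    rewrite leeD2l//; apply: (le_trans (le1 _ oKc)); rewrite muE//.
    exact: inner_le_fa.
  by rewrite mKc -EFinD addrC subrK.
pose gm : {mfun borelT >-> borelT} := HB.pack (g : borelT -> borelT)
  (isMeasurableFun.Build _ _ borelT borelT g mgf).
move=> B mB.
transitivity (pushforward mu gm B); first by [].
pose oo := @open T : set (set borelT).
apply: (@measure_unique _ R borelT oo (fun _ => setT) _ _ _ _ (pushforward mu gm) mu) => //.
- exact: openI.
- by move=> _; exact: openT.
- by rewrite bigcup_const//; exists 0%N.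
- by move=> U oU; apply/eqP; rewrite eq_le; apply/andP; split; [exact: le1|exact: ge1].
- by move=> _; apply: (le_lt_trans (le1 _ (@openT T))); rewrite probability_setT ltry.
Qed.

End RegularMeasure.

(** * Limits of empirical measures *)

Section Ultralimit.
Context {R : realType} {T : Type}.

(** A cluster point exists by compactness, and it is a limit because the filter
    decides every set. *)
Lemma ultra_bounded_cvg (F : set_system nat) (u : nat -> R) (a b : R) :
  UltraFilter F -> (forall k, a <= u k <= b) -> exists l : R, u k @[k --> F] --> l.
Proof.
move=> UF ub.
have FS : F (u @^-1` `[a, b]) by apply: filterE => k; rewrite /= in_itv/=.
have [l [_ cl]] := @segment_compact R a b (u k @[k --> F]) _ FS.
exists l => V Vl.
have [//|FnV] := in_ultra_setVsetC (u @^-1` V) UF.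
by have [y [nVy Vy]] := cl (~` V) V FnV Vl.
Qed.

Lemma ultralimit_fin_add_prob (F : set_system nat) (nu : nat -> fin_add_prob R T) :
  UltraFilter F -> exists m : fin_add_prob R T, forall B, nu k B @[k --> F] --> m B.
Proof.
move=> UF.
have H B : exists l : R, nu k B @[k --> F] --> l.
  apply: (@ultra_bounded_cvg _ _ 0 1) => k; rewrite fa_ge0/=; exact: fa_le1.
have [v Hv] := choice H.
have v0 B : 0 <= v B.
  by apply: (cvgr_to_ge (Hv B)); apply: filterE => k; exact: fa_ge0.
have vT : v setT = 1.
  have e : (fun k => nu k setT) = cst 1 by apply/funext => k; exact: fa_setT.
  have := Hv setT; rewrite e => /(cvg_unique (@Rhausdorff R)); apply.
  exact: cvg_cst.
have vU B C : B `&` C = set0 -> v (B `|` C) = v B + v C.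
  move=> BC; have e : (fun k => nu k (B `|` C)) = (fun k => nu k B + nu k C).
    by apply/funext => k; exact: fa_setU.
  have := Hv (B `|` C); rewrite e => /(cvg_unique (@Rhausdorff R)); apply.
  exact: cvgD.
by exists (FinAddProb v0 vT vU).
Qed.

End Ultralimit.

Section Empirical.
Context {R : realType} {T : Type} (g : T -> T).

Lemma visits_setT n x : visits g setT n x = n.
Proof.
rewrite /visits; under eq_bigr do rewrite (_ : `[< _ >] = true) ?asboolT//.
by rewrite sum_nat_const_nat subn0 muln1.
Qed.

Lemma visits_setU n x B C : B `&` C = set0 ->
  visits g (B `|` C) n x = (visits g B n x + visits g C n x)%N.
Proof.
move=> BC; rewrite /visits -big_split/=; apply: eq_bigr => i _.
set y := iter i g x; have nBC : B y -> C y -> False.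
  by move=> By Cy; have : (B `&` C) y by []; rewrite BC.
case: (pselect (B y)) => By; case: (pselect (C y)) => Cy.
- by have := nBC By Cy.
- by rewrite (asboolT (_ : (B `|` C) y)) ?(asboolT By) ?(asboolF Cy)//; left.
- by rewrite (asboolT (_ : (B `|` C) y)) ?(asboolT Cy) ?(asboolF By)//; right.
- by rewrite (asboolF (_ : ~ (B `|` C) y)) ?(asboolF Cy) ?(asboolF By)// => -[].
Qed.

(** Passing to the preimage shifts the orbit segment by one step, which changes
    only its two ends; this is why empirical measures are nearly invariant. *)
Lemma visits_preimage n x B :
  (visits g (g @^-1` B) n x + `[< B x >] = visits g B n x + `[< B (iter n g x) >])%N.
Proof.
rewrite /visits; under eq_bigr do rewrite -[asbool _]/(`[< B (iter _.+1 g x) >]).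
rewrite addnC -(big_nat_recl n 0 (fun i => nat_of_bool `[< B (iter i g x) >]))//.
by rewrite big_nat_recr.
Qed.

(** The average of the Dirac masses at the points of the orbit segments of
    length [n.+1] that start at the [k.+1] points [pt]. *)
Definition empirical_val n k (pt : 'I_k.+1 -> T) (B : set T) : R :=
  (\sum_s visits g B n.+1 (pt s))%N%:R / (n.+1 * k.+1)%:R.

Lemma empirical n k (pt : 'I_k.+1 -> T) : exists nu : fin_add_prob R T,
  forall B, nu B = empirical_val n pt B.
Proof.
have nk0 : (n.+1 * k.+1)%:R != 0 :> R by rewrite pnatr_eq0.
have v0 B : 0 <= empirical_val n pt B by rewrite divr_ge0.
have vT : empirical_val n pt setT = 1.
  rewrite /empirical_val; under eq_bigr do rewrite visits_setT.
  by rewrite sum_nat_const card_ord mulnC divff.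
have vU B C : B `&` C = set0 -> empirical_val n pt (B `|` C) = empirical_val n pt B + empirical_val n pt C.
  move=> BC; rewrite /empirical_val; under eq_bigr do rewrite visits_setU//.
  by rewrite big_split/= natrD mulrDl.
by exists (FinAddProb v0 vT vU).
Qed.

Lemma empirical_invariant n k (pt : 'I_k.+1 -> T) B :
  `|empirical_val n pt (g @^-1` B) - empirical_val n pt B| <= (n.+1%:R)^-1.
Proof.
rewrite /empirical_val -mulrBl normrM [X in _ * X]ger0_norm ?invr_ge0//.
rewrite natrM invfM mulrCA ler_piMr ?invr_ge0// ler_pdivrMr ?ltr0n// mul1r.
rewrite !natr_sum -sumrB; apply: (le_trans (ler_norm_sum _ _ _)).
apply: (@le_trans _ _ (\sum_(s < k.+1) 1)); last first.
  by rewrite sumr_const card_ord.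
apply: ler_sum => s _; have := visits_preimage n.+1 (pt s) B.
move/(congr1 (fun i : nat => i%:R : R)); rewrite !natrD => e.
have -> : (visits g (g @^-1` B) n.+1 (pt s))%:R - (visits g B n.+1 (pt s))%:R =
  (`[< B (iter n.+1 g (pt s)) >])%:R - (`[< B (pt s) >])%:R :> R.
  by move: e; lra.
by case: `[< _ >]; case: `[< _ >]; rewrite ?subrr ?subr0 ?sub0r ?normrN ?normr1 ?normr0.
Qed.

Lemma ultralimit_invariant (F : set_system nat) (nu : nat -> fin_add_prob R T) (m : fin_add_prob R T) B :
  UltraFilter F -> F --> \oo ->
  (forall n, `|nu n (g @^-1` B) - nu n B| <= (n.+1%:R)^-1) ->
  (forall B, nu n B @[n --> F] --> m B) -> m (g @^-1` B) = m B.
Proof.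
move=> UF Foo Hn Hm.
apply/eqP; rewrite -subr_eq0 -normr_eq0; apply/eqP.
apply: (@cvg_unique _ _ (`|nu n (g @^-1` B) - nu n B| @[n --> F])) => //.
  by apply: cvg_norm; apply: cvgB.
apply: (@squeeze_cvgr _ _ _ _ (fun _ => 0) (fun n => n.+1%:R^-1)).
- by apply: filterE => n; rewrite normr_ge0 Hn.
- exact: cvg_cst.
- apply: cvg_trans (@cvg_harmonic R); exact: cvg_app.
Qed.
End Empirical.

(** * Curves and speed in charts *)

(** Expresses a directional derivative through finitely many fixed directions,
    along which the derivatives are known to be continuous. *)
Lemma derive_rV (R : realType) (n m : nat) (F : 'rV[R]_n -> 'rV[R]_m) x w :
  differentiable F x -> 'D_w F x = \sum_(k < n) w 0 k *: 'D_(delta_mx 0 k) F x.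
Proof.
move=> dF; rewrite deriveE// {1}(row_sum_delta w) linear_sum.
by apply: eq_bigr => k _; rewrite linearZ deriveE.
Qed.

Lemma cvg_sumr (R : realType) (V : normedModType R) (I : finType) (T : Type)
    (F : set_system T) {FF : Filter F} (f : I -> T -> V) (l : I -> V) :
  (forall i, f i x @[x --> F] --> l i) ->
  \sum_i f i x @[x --> F] --> \sum_i l i.
Proof. by move=> fl; apply: cvg_big => [|i _]; [exact: add_continuous|exact: fl]. Qed.

Lemma chain_rule (R : realType) (n m : nat) (F : 'rV[R]_n -> 'rV[R]_m)
    (u : R -> 'rV[R]_n) (t : R) :
  derivable u t 1 -> differentiable F (u t) ->
  derivable (F \o u) t 1 /\ derive1 (F \o u) t = 'D_(derive1 u t) F (u t).
Proof.
move=> /derivable1_diffP du dF.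
have dFu : differentiable (F \o u) t by exact: differentiable_comp.
split; first exact/derivable1_diffP.
by rewrite !derive1E deriveE// diff_comp// deriveE// deriveE.
Qed.

(** A pointwise form of being C1, stable under the operations on curves below:
    differentiable near [t], with a derivative that is continuous at [t]. *)
Definition C1_fun_at (R : realType) n (u : R -> 'rV[R]_n) (t : R) : Prop :=
  (\forall s \near t, derivable u s 1) /\ {for t, continuous (derive1 u)}.

Lemma C1_fun_comp (R : realType) (n m : nat) (W : set 'rV[R]_n)
    (F : 'rV[R]_n -> 'rV[R]_m) (u : R -> 'rV[R]_n) (t : R) :
  open W -> Ck_on 1 W F -> W (u t) -> C1_fun_at u t -> C1_fun_at (F \o u) t.
Proof.
move=> oW [dF cF] Wut [du cu].
have ut : {for t, continuous u}.
  apply: differentiable_continuous; apply/derivable1_diffP.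
  exact: nbhs_singleton du.
have nW : \forall s \near t, W (u s) by apply: ut; exact: open_nbhs_nbhs.
have nFu : \forall s \near t, derivable (F \o u) s 1 /\
    derive1 (F \o u) s =
      \sum_(k < n) (derive1 u s) 0 k *: 'D_(delta_mx 0 k) F (u s).
  near=> s.
  have dFs : differentiable F (u s) by apply: dF; near: s.
  have dus : derivable u s 1 by near: s.
  have [d e] := chain_rule dus dFs.
  by split=> //; rewrite e derive_rV.
split; first by apply: filterS nFu => s [].
rewrite /prop_for /continuous_at.
have [_ ->] := nbhs_singleton nFu.
apply: (@cvg_trans _ ((\sum_(k < n) (derive1 u s) 0 k *:
    'D_(delta_mx 0 k) F (u s)) @[s --> t])).
  by apply: near_eq_cvg; apply: filterS nFu => s [_ ->].
apply: (@cvg_sumr _ _ _ _ (nbhs t) _ (fun k s => (derive1 u s) 0 k *: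
    'D_(delta_mx 0 k) F (u s))) => k.
apply: cvgZ.
  exact: (cvg_comp _ _ cu (@coord_continuous _ _ _ 0 k _)).
exact: (cvg_comp _ _ ut (cF (delta_mx 0 k) _ Wut)).
Unshelve. all: by end_near. Qed.

Lemma C1_fun_at_near (R : realType) n (u v : R -> 'rV[R]_n) (t : R) :
  (\forall s \near t, u s = v s) -> C1_fun_at u t -> C1_fun_at v t.
Proof.
move=> e [d1 d2].
have e' : \forall s \near t, \forall r \near s, u r = v r by exact: nbhs_interior.
split.
  by apply: filterS2 e' d1 => s es; exact: near_eq_derivable.
rewrite /prop_for /continuous_at.
have ed : \forall s \near t, derive1 u s = derive1 v s.
  by apply: filterS e' => s es; rewrite !derive1E; exact: near_eq_derive.
rewrite -(nbhs_singleton ed).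
by apply: cvg_trans d2; apply: near_eq_cvg.
Qed.

Section Riemannian.
Context {R : realType} {M : ptopologicalType} {n : nat}.
Variable A : riemannianManifold R M n.
Implicit Types i j : chart A.

Lemma chart_nbhs i x : dom i x -> \forall y \near x, dom i y.
Proof. by move=> dx; apply: open_nbhs_nbhs; split=> //; exact: open_dom. Qed.

Lemma open_phi_image i O : open O -> open (phi i @` (dom i `&` O)).
Proof.
move=> oO; rewrite openE => _ [x [dx Ox] <-].
have xi : (phi i @` dom i) (phi i x) by exists x.
have nO : \forall u \near phi i x, O (psi i u).
  by apply: (psi_continuous xi); rewrite phiK//; exact: open_nbhs_nbhs.
have nd : \forall u \near phi i x, (phi i @` dom i) u.
  by apply: open_nbhs_nbhs; split=> //; exact: open_codom.
rewrite /interior; near=> u.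
have [y dy yu] : (phi i @` dom i) u by near: u.
exists y => //; split=> //.
by rewrite -(phiK dy) yu; near: u.
Unshelve. all: by end_near. Qed.

Lemma transition_C1 i j : Ck_on 1 (phi i @` (dom i `&` dom j))
  (phi j \o psi i).
Proof. exact: (transition_smooth i j 1%N). Qed.

Definition C1_at (c : R -> M) (t : R) : Prop :=
  {for t, continuous c} /\
  forall i : chart A, dom i (c t) -> C1_fun_at (phi i \o c) t.

Lemma C1_at_near (c c' : R -> M) t : (\forall s \near t, c s = c' s) ->
  C1_at c t -> C1_at c' t.
Proof.
move=> e [cc dc]; have ect := nbhs_singleton e.
split.
  rewrite /prop_for /continuous_at -ect.
  by apply: cvg_trans cc; apply: near_eq_cvg; apply: filterS e => s ->.
move=> i; rewrite -ect => /dc; apply: C1_fun_at_near.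
by apply: filterS e => s /= ->.
Qed.

Lemma gram_continuous i u : (phi i @` dom i) u -> {for u, continuous (gram i)}.
Proof. by move=> ?; exact: (gram_smooth (r:=A) i 0%N). Qed.

(** The speed is defined in the preferred chart, which may vary
    discontinuously along the curve. The compatibility of the Gram matrices allows one to compute
    it in any fixed chart. *)
Lemma speed_chart (c : R -> M) t i : {for t, continuous c} -> dom i (c t) ->
  derivable (phi i \o c) t 1 ->
  let w := derive1 (phi i \o c) t in
  speed A c t = Num.sqrt ((w *m gram i (phi i (c t)) *m w^T) 0 0).
Proof.
move=> cc di dc w; rewrite /speed /tnorm.
set j := chart_at A (c t).
have dj : dom j (c t) by exact: chart_atP.
have inW : (phi i @` (dom i `&` dom j)) (phi i (c t)) by exists (c t).
have [dF _] := transition_C1 i j.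
have [d e] := chain_rule dc (dF _ inW).
have near_eq : \forall s \near t, ((phi j \o psi i) \o (phi i \o c)) s =
    (phi j \o c) s.
  have : \forall s \near t, dom i (c s) by apply: cc; exact: chart_nbhs.
  by apply: filterS => s /= ds; rewrite phiK.
have -> : derive1 (phi j \o c) t = 'D_w (phi j \o psi i) (phi i (c t)).
  by rewrite -e !derive1E; apply/esym; exact: near_eq_derive.
by rewrite (gram_compat w w di dj).
Qed.

Lemma speed_continuous (c : R -> M) t : (\forall s \near t, C1_at c s) ->
  {for t, continuous (speed A c)}.
Proof.
move=> Cc; have [cc dc] := nbhs_singleton Cc.
set i := chart_at A (c t).
have di : dom i (c t) by exact: chart_atP.
have [du cu] := dc _ di.
set u := phi i \o c.
pose q s := Num.sqrt ((derive1 u s *m gram i (u s) *m (derive1 u s)^T) 0 0).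
have nd : \forall s \near t, dom i (c s) by apply: cc; exact: chart_nbhs.
have eq : \forall s \near t, q s = speed A c s.
  near=> s; apply/esym; apply: speed_chart; [|by near: s..].
  by have [] : C1_at c s by near: s.
rewrite /prop_for /continuous_at -(nbhs_singleton eq).
apply: (@cvg_trans _ (q s @[s --> t])); first exact: near_eq_cvg.
pose r s := (derive1 u s *m gram i (u s) *m (derive1 u s)^T) 0 0.
suff cr : {for t, continuous r} by exact: (cvg_comp _ _ cr (@sqrt_continuous R _)).
have cut : {for t, continuous u}.
  by apply: differentiable_continuous; apply/derivable1_diffP; exact: nbhs_singleton du.
have cg : {for u t, continuous (gram i)} by apply: gram_continuous; exists (c t).
rewrite /prop_for /continuous_at /r !mxE.
under eq_fun do rewrite !mxE.
apply: (@cvg_sumr _ _ _ _ (nbhs t) _ (fun k s =>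
  (derive1 u s *m gram i (u s)) 0 k * (derive1 u s)^T k 0)) => k.
rewrite !mxE; under eq_fun do rewrite !mxE.
apply: cvgM; last exact: (cvg_comp _ _ cu (@coord_continuous _ _ _ 0 k _)).
apply: (@cvg_sumr _ _ _ _ (nbhs t) _ (fun l s =>
  derive1 u s 0 l * gram i (u s) l k)) => l.
apply: cvgM; first exact: (cvg_comp _ _ cu (@coord_continuous _ _ _ 0 l _)).
have := cvg_comp _ _ cut cg => /= cgu.
exact: (cvg_comp _ _ cgu (@coord_continuous _ _ _ l k _)).
Unshelve. all: by end_near. Qed.

End Riemannian.

Lemma derive_scale (R : realType) (V : normedModType R) (f : R -> V) (s v : R) :
  derivable f s 1 -> 'D_v f s = v *: derive1 f s.
Proof.
by move=> ds; rewrite deriveE; [rewrite deriv1E|exact/derivable1_diffP].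
Qed.

Lemma near_comp (T U : topologicalType) (u : T -> U) (t : T) (P : set U) :
  {for t, continuous u} -> (\forall y \near u t, P y) -> \forall s \near t, P (u s).
Proof. by move=> cu; exact: cu. Qed.

Lemma derive1_affine (R : realType) (k m s : R) :
  derive1 (fun s : R => k * s + m) s = k.
Proof.
have -> : (fun s : R => k * s + m) = k *: id + cst m by apply/funext.
rewrite derive1E deriveD// ?deriveZ// ?derive_cst ?derive_id ?addr0.
by rewrite -[k *: 1]/(k * 1) mulr1.
Qed.

Lemma derive1_comp_affine (R : realType) (V : normedModType R) (f : R -> V)
    (k m s : R) : derivable f (k * s + m) 1 ->
  derivable (f \o (fun s : R => k * s + m)) s 1 /\
  derive1 (f \o (fun s : R => k * s + m)) s = k *: derive1 f (k * s + m).
Proof.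
set h := (fun s : R => k * s + m) => /derivable1_diffP df.
have dh : differentiable h s.
  by apply/derivable1_diffP; apply: derivableD => //; apply: derivableM.
have dfh : differentiable (f \o h) s by exact: differentiable_comp.
split; first exact/derivable1_diffP.
have e : 'd h s 1 = k by rewrite -deriveE// -derive1E; exact: derive1_affine.
rewrite derive1E deriveE// diff_comp//= e.
by rewrite -deriveE// derive_scale//; exact/derivable1_diffP.
Qed.

Section Curves.
Context {R : realType} {M : ptopologicalType} {n : nat}.
Variable A : riemannianManifold R M n.
Implicit Types i j : chart A.
Implicit Types (c : R -> M) (a b t : R) (U : set R).

Lemma C1_curve_onP U c : open U ->
  C1_curve_on A U c <-> (forall t, U t -> C1_at A c t).
Proof.
move=> oU; split=> [[cc dc] t Ut|Cc].
  split; first exact: cc.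
  move=> i di.
  have nd : \forall s \near t, U s /\ dom i (c s).
    apply: filterI; first exact: open_nbhs_nbhs.
    by apply: cc => //; exact: chart_nbhs.
  have [d1 d2] := dc i.
  split.
    by apply: filterS nd => s Uds; apply/derivable1_diffP; exact: d1.
  have -> : derive1 (phi i \o c) = 'D_1 (phi i \o c).
    by apply/funext => s; rewrite derive1E.
  exact: (d2 1 t).
split; first by move=> t /Cc[].
move=> i; split.
  move=> t [Ut di]; have [_ Cci] := Cc _ Ut; have [d1 _] := Cci i di.
  have /derivable1_diffP := nbhs_singleton d1; exact.
move=> v t [Ut di].
have [_ /(_ i di)[d1 d2]] := Cc _ Ut.
have e : \forall s \near t, v *: derive1 (phi i \o c) s = 'D_v (phi i \o c) s.
  by apply: filterS d1 => s ds; apply/esym; exact: derive_scale.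
rewrite /prop_for /continuous_at -(nbhs_singleton e).
apply: cvg_trans; first exact: (near_eq_cvg e).
exact: cvgZl_tmp.
Qed.

Lemma C1_at_affine c k m t : C1_at A c (k * t + m) -> C1_at A (fun s => c (k * s + m)) t.
Proof.
move=> [cc dc].
have da s : derivable (fun s : R => k * s + m) s 1.
  by apply: derivableD => //; apply: derivableM.
have ca : {for t, continuous (fun s : R => k * s + m)}.
  by apply: differentiable_continuous; apply/derivable1_diffP.
split; first exact: (cvg_comp _ _ ca cc).
move=> i di; have [d1 d2] := dc i di.
have n1 : \forall s \near t, derivable (phi i \o c) (k * s + m) 1.
  exact: (@near_comp R R (fun s => k * s + m) t
    (fun r => derivable (phi i \o c) r 1) ca d1).
have n2 : \forall s \near t, derivable (phi i \o (fun s => c (k * s + m))) s 1 /\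
    k *: derive1 (phi i \o c) (k * s + m) =
    derive1 (phi i \o (fun s => c (k * s + m))) s.
  by apply: filterS n1 => s /derive1_comp_affine[d e]; split=> //; rewrite -e.
split; first by apply: filterS n2 => s [].
rewrite /prop_for /continuous_at.
have [_ <-] := nbhs_singleton n2.
apply: (@cvg_trans _ (k *: derive1 (phi i \o c) (k * s + m) @[s --> t])).
  by apply: near_eq_cvg; apply: filterS n2 => s [].
have cd := cvg_comp _ _ ca d2.
exact: (@cvgZl_tmp _ _ _ (nbhs t) _ k _ _ cd).
Qed.

Lemma speed_affine c k m t : C1_at A c (k * t + m) ->
  speed A (fun s => c (k * s + m)) t = `|k| * speed A c (k * t + m).
Proof.
move=> [cc dc]; set i := chart_at A (c (k * t + m)).
have di : dom i (c (k * t + m)) by exact: chart_atP.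
have [d1 _] := dc i di.
have [_ e] := derive1_comp_affine (nbhs_singleton d1).
rewrite /speed /tnorm -/i.
have -> : derive1 (phi i \o (fun s => c (k * s + m))) t =
  k *: derive1 (phi i \o c) (k * t + m) by rewrite -e.
rewrite -scalemxAl linearZ/= -scalemxAl -scalemxAr !mxE mulrA -expr2.
by rewrite sqrtrM ?sqr_ge0// sqrtr_sqr.
Qed.

End Curves.

Section Tangent.
Context {R : realType} {M : ptopologicalType} {n : nat}.
Variable A : riemannianManifold R M n.
Implicit Types i j : chart A.
Implicit Types (c : R -> M) (a b t : R) (U : set R) (g : M -> M).

Lemma tnormZ x k v : tnorm A x (k *: v) = `|k| * tnorm A x v.
Proof.
rewrite /tnorm -scalemxAl linearZ/= -scalemxAl -scalemxAr !mxE mulrA -expr2.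
by rewrite sqrtrM ?sqr_ge0// sqrtr_sqr.
Qed.

Lemma tnorm_ge0 x v : 0 <= tnorm A x v.
Proof. exact: sqrtr_ge0. Qed.

Lemma tnorm_gt0 x v : v != 0 -> 0 < tnorm A x v.
Proof.
move=> v0; rewrite sqrtr_gt0; apply: gram_pos => //.
by exists x => //; exact: chart_atP.
Qed.

(** The operator norm only controls unit vectors, hence the rescaling; vectors of
    norm 0 are 0 because the Gram matrices are positive definite. *)
Lemma tnorm_tmap g (L : R) x v : C1_map A g -> (normD A g <= L%:E)%E ->
  tnorm A (g x) (tmap A g x v) <= L * tnorm A x v.
Proof.
move=> [cg Cg] gL.
have [->|v0] := eqVneq v 0.
  by rewrite /tmap derive0 -(scale0r 0) !tnormZ normr0 !mul0r mulr0.
have p := tnorm_gt0 x v0; set k := tnorm A x v in p *.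
have dg : differentiable (phi (chart_at A (g x)) \o g \o psi (chart_at A x))
    (phi (chart_at A x) x).
  have [+ _] := Cg (chart_at A x) (chart_at A (g x)); apply; exists x => //.
  by split; exact: chart_atP.
have tZ : tmap A g x (k^-1 *: v) = k^-1 *: tmap A g x v.
  by rewrite /tmap !deriveE// linearZ.
have : ((tnorm A (g x) (tmap A g x (k^-1 *: v)))%:E <= normD A g)%E.
  apply: ereal_sup_ubound; exists (x, k^-1 *: v) => //=.
  by rewrite tnormZ gtr0_norm ?invr_gt0// -/k mulVf ?gt_eqF.
move=> /le_trans/(_ gL); rewrite lee_fin tZ tnormZ gtr0_norm ?invr_gt0//.
by rewrite mulrC ler_pdivrMr.
Qed.

Lemma C1_at_map g c t : C1_map A g -> C1_at A c t -> C1_at A (g \o c) t.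
Proof.
move=> [cg Cg] [cc dc]; split; first exact: (cvg_comp _ _ cc (cg (c t))).
move=> j dj; set i := chart_at A (c t).
have di : dom i (c t) by exact: chart_atP.
have oW : open (phi i @` (dom i `&` g @^-1` dom j)).
  apply: open_phi_image; move/continuousP: cg; apply; exact: open_dom.
have inW : (phi i @` (dom i `&` g @^-1` dom j)) (phi i (c t)) by exists (c t).
apply: C1_fun_at_near (C1_fun_comp oW (Cg i j) inW (dc i di)).
have : \forall s \near t, dom i (c s) by apply: cc; exact: chart_nbhs.
by apply: filterS => s /= ds; rewrite phiK.
Qed.

Lemma speed_map g c t (L : R) : C1_map A g -> (normD A g <= L%:E)%E ->
  C1_at A c t -> speed A (g \o c) t <= L * speed A c t.
Proof.
move=> Cg gL [cc dc]; rewrite /speed; set i := chart_at A (c t).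
have di : dom i (c t) by exact: chart_atP.
have [d1 _] := dc i di.
apply: le_trans (tnorm_tmap (c t) _ Cg gL).
suff -> : derive1 (phi (chart_at A ((g \o c) t)) \o (g \o c)) t =
   tmap A g (c t) (derive1 (phi i \o c) t) by [].
set j := chart_at A ((g \o c) t).
have inW : (phi i @` (dom i `&` g @^-1` dom j)) (phi i (c t)).
  by exists (c t) => //; split=> //; exact: chart_atP.
have [_ Cg'] := Cg; have [dF _] := Cg' i j.
have [_ e] := chain_rule (nbhs_singleton d1) (dF _ inW).
apply: etrans e; rewrite !derive1E; apply: near_eq_derive.
have : \forall s \near t, dom i (c s) by apply: cc; exact: chart_nbhs.
by apply: filterS => s /= ds; rewrite phiK.
Qed.

Lemma C1_at_cst x t : C1_at A (cst x) t.
Proof.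
split; first exact: cvg_cst.
move=> i di; have e : phi i \o cst x = cst (phi i x) :> (R -> _) by [].
split; rewrite e; first by near=> s; exact: derivable_cst.
have -> : derive1 (cst (phi i x) : R -> 'rV[R]_n) = cst 0.
  by apply/funext => s; rewrite derive1_cst.
exact: cvg_cst.
Unshelve. all: by end_near. Qed.

Lemma speed_cst x t : speed A (cst x) t = 0.
Proof.
rewrite /speed; set i := chart_at A _.
have -> : phi i \o cst x = cst (phi i x) :> (R -> _) by [].
by rewrite derive1_cst -(scale0r 0) tnormZ normr0 mul0r.
Qed.

(** Segments in a chart serve to bound distances between nearby points. *)
Lemma C1_at_segment i (u w : 'rV[R]_n) t : (phi i @` dom i) (u + t *: w) ->
  C1_at A (fun s => psi i (u + s *: w)) t /\
  speed A (fun s => psi i (u + s *: w)) t =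
    Num.sqrt ((w *m gram i (u + t *: w) *m w^T) 0 0).
Proof.
pose l s := u + s *: w; pose c s := psi i (l s).
rewrite -/(l t) -/c => lt.
have dl s : derivable l s 1.
  apply: derivableD => //; apply: diff_derivable; exact: differentiableZl.
have d1l : derive1 l = cst w.
  apply/funext => s; rewrite derive1E deriveD//; last first.
    by apply: diff_derivable; exact: differentiableZl.
  rewrite derive_cst add0r deriveE; last exact: differentiableZl.
  by rewrite diffZl//= diff_val/= scale1r.
have cl : {for t, continuous l}.
  by apply: differentiable_continuous; apply/derivable1_diffP.
have Cl : C1_fun_at l t.
  by split; [near=> s; exact: dl|rewrite d1l; exact: cvg_cst].
have ct : {for t, continuous c} by exact: (cvg_comp _ _ cl (psi_continuous lt)).
have nl : \forall s \near t, (phi i @` dom i) (l s).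
  apply: (@near_comp _ _ l t (phi i @` dom i) cl).
  by apply: open_nbhs_nbhs; split=> //; exact: open_codom.
have di : dom i (c t) by have [y dy e] := lt; rewrite /c -e phiK.
have C : C1_at A c t.
  split; first exact: ct.
  move=> j dj; have dij : (phi i @` (dom i `&` dom j)) (l t).
    have [y dy e] := lt; move: dj; rewrite /c -e phiK// => dj.
    by exists y.
  have H := C1_fun_comp (open_phi_image (open_dom j)) (transition_C1 i j) dij Cl.
  by apply: C1_fun_at_near H; apply: filterS nl.
have el : \forall s \near t, l s = (phi i \o c) s.
  by apply: filterS nl => s [y dy e] /=; rewrite /c -e phiK.
split=> //.
have [_ dc] := C; have [d1 _] := dc i di.
rewrite (speed_chart ct di (nbhs_singleton d1)).
have -> : derive1 (phi i \o c) t = w.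
  have -> : w = derive1 l t by rewrite d1l.
  by rewrite !derive1E; apply/esym; exact: near_eq_derive.
by rewrite -[phi i (c t)]/((phi i \o c) t) -(nbhs_singleton el).
Unshelve. all: by end_near. Qed.

End Tangent.

(** * Piecewise C1 curves and their lengths *)

Section Lengths.
Context {R : realType} {M : ptopologicalType} {n : nat}.
Variable A : riemannianManifold R M n.
Implicit Types (c : R -> M) (a b t : R) (g : M -> M).
Notation mu := (@lebesgue_measure R).

Definition C1_piece c a b := exists (U : set R) (c' : R -> M),
  [/\ open U, `[a, b] `<=` U, (forall t, U t -> C1_at A c' t) &
      forall t, t \in `[a, b] -> c t = c' t].

(** An inductive form of piecewise C1 curves, suited to concatenation,
    reversal and computations of length; see [pwC1P]. *)
Inductive pwC1 c : R -> R -> Prop :=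
| pwC1_nil a : pwC1 c a a
| pwC1_cons a x b : a < x -> C1_piece c a x -> pwC1 c x b -> pwC1 c a b.

Lemma C1_piece_curve c a b : C1_piece c a b <->
  exists (U : set R) (c' : R -> M),
    [/\ open U, `[a, b] `<=` U, C1_curve_on A U c' &
        forall t, t \in `[a, b] -> c t = c' t].
Proof.
by split=> -[U [c' [oU sU Cc e]]]; exists U, c'; split=> //; apply/C1_curve_onP.
Qed.

Lemma pwC1P c : pw_C1_curve A c <-> pwC1 c 0 1.
Proof.
have gen s : forall a b, path <%O a s -> last a s == b ->
    (forall i, (i < size s)%N -> C1_piece c (nth 0 (a :: s) i) (nth 0 (a :: s) i.+1)) ->
    pwC1 c a b.
  elim: s => [|x s IH] a b /=; first by move=> _ /eqP <- _; exact: pwC1_nil.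
  move=> /andP[ax ps] lb Cs; apply: (pwC1_cons ax); first exact: (Cs 0%N).
  by apply: IH => // i; exact: (Cs i.+1).
split=> [[s [[ps ls] Cs]]|].
  by apply: gen ps ls _ => i /Cs /C1_piece_curve.
have rev a b : pwC1 c a b -> exists s, [/\ path <%O a s, last a s == b &
    forall i, (i < size s)%N -> C1_piece c (nth 0 (a :: s) i) (nth 0 (a :: s) i.+1)].
  elim=> [{}a|{}a x {}b ax ca _ [s [ps ls Cs]]]; first by exists [::].
  exists (x :: s); split=> //=; first by rewrite ax.
  by case=> [_|i si]; [exact: ca|exact: (Cs i)].
move=> /rev[s [ps ls Cs]]; exists s; split=> // i /Cs.
by move/C1_piece_curve.
Qed.

Lemma pwC1_le c a b : pwC1 c a b -> a <= b.
Proof. by elim=> // {}a x {}b ax _ _; apply: le_trans; exact: ltW. Qed.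

Definition arc_len c a b : \bar R := (\int[mu]_(t in `[a, b]) (speed A c t)%:E)%E.

Lemma speed_ge0 c t : 0 <= speed A c t.
Proof. exact: tnorm_ge0. Qed.

Lemma len_ge0 c a b : (0 <= arc_len c a b)%E.
Proof. by apply: integral_ge0 => t _; rewrite lee_fin speed_ge0. Qed.

Lemma len_nil c a : arc_len c a a = 0%E.
Proof. by rewrite /arc_len set_itv1 integral_set1. Qed.

Lemma C1_piece_at c a b t : C1_piece c a b -> t \in `]a, b[ ->
  \forall s \near t, C1_at A c s.
Proof.
move=> [U [c' [oU sU Cc e]]] tab.
have ab s : s \in `]a, b[ -> s \in `[a, b] by apply: subset_itvW.
have : \forall s \near t, \forall r \near s, r \in `]a, b[.
  apply: nbhs_interior; exact: near_in_itvoo.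
apply: filterS => s ns; apply: (@C1_at_near _ _ _ A c').
  by apply: filterS ns => r rab; rewrite e//; exact: ab.
apply: Cc; apply: sU; apply: ab; exact: nbhs_singleton ns.
Qed.

Lemma C1_piece_meas c a b : C1_piece c a b ->
  measurable_fun `[a, b] (speed A c).
Proof.
move=> Cc; apply: (@measurable_realfun.measurable_fun_itv_cc _ _ _ false true).
apply: measurable_realfun.open_continuous_measurable_fun; first exact: interval_open.
move=> t /set_mem/= tab; apply: speed_continuous; exact: C1_piece_at tab.
Qed.

(** The speed is continuous inside each piece, but unspecified at the end points
    of the pieces, where it does not affect integrals. *)
Lemma pwC1_meas c a b : pwC1 c a b -> measurable_fun `[a, b] (speed A c).
Proof.
elim=> [{}a|{}a x {}b ax Cc /pwC1_le xb IH]; first by rewrite set_itv1; exact: measurable_fun_set1.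
have ax' := ltW ax.
rewrite (@itv_bndbnd_setU _ _ _ (BLeft x)); [|by rewrite bnd_simp..].
apply/measurable_funU => //; split=> //.
apply: measurable_funS (C1_piece_meas Cc) => //.
by apply: subset_itvl; rewrite bnd_simp.
Qed.

Lemma len_cat c a x b : a <= x -> x <= b -> measurable_fun `[a, b] (speed A c) ->
  arc_len c a b = (arc_len c a x + arc_len c x b)%E.
Proof.
move=> ax xb mc.
rewrite /arc_len (@itv_bndbnd_setU _ _ _ (BRight x)); [|by rewrite bnd_simp..].
have sub : `]x, b] `<=` `[a, b] by apply: subset_itvr; rewrite bnd_simp.
have mE (D : set R) : measurable D -> D `<=` `[a, b] ->
    measurable_fun D (fun t => (speed A c t)%:E).
  by move=> mD DS; apply/measurable_EFinP; apply: measurable_funS DS mc.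
rewrite ge0_integral_setU//=.
- congr (_ + _)%E; apply: integral_itv_obnd_cbnd; exact: mE.
- by rewrite -itv_bndbnd_setU; [exact: mE|rewrite bnd_simp..].
- by move=> t _; rewrite lee_fin speed_ge0.
- apply/disj_setPS => t /=; rewrite !in_itv/= => -[/andP[_ tx] /andP[+ _]].
  by rewrite ltNge tx.
Qed.

Lemma pwC1_cat c a b e : pwC1 c a b -> pwC1 c b e -> pwC1 c a e.
Proof. by elim=> // {}a x {}b ax Cc _ IH /IH; exact: pwC1_cons. Qed.

(** The extension [c'] has a speed that is continuous up to the end points,
    which is what changes of variable require. *)
Lemma C1_piece_len c c' a b (U : set R) : `[a, b] `<=` U -> open U ->
  (forall t, U t -> C1_at A c' t) -> (forall t, t \in `[a, b] -> c t = c' t) ->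
  arc_len c a b = arc_len c' a b /\ {within `[a, b], continuous (speed A c')}.
Proof.
move=> sU oU Cc e; split.
  have C1 : C1_piece c a b by exists U, c'.
  have C2 : C1_piece c' a b by exists U, c'.
  have sub : `]a, b[ `<=` `[a, b] by exact: subset_itvW.
  apply: eq_integral_itv_bounded.
  - exact: measurable_funS (C1_piece_meas C1).
  - exact: measurable_funS (C1_piece_meas C2).
  move=> t tab; rewrite /speed.
  have et : \forall s \near t, c s = c' s.
    have : \forall s \near t, s \in `]a, b[ by exact: near_in_itvoo.
    by apply: filterS => s sab; apply: e; exact: sub.
  rewrite (nbhs_singleton et) !derive1E; congr (tnorm A _ _).
  by apply: near_eq_derive; apply: filterS et => s /= ->.
apply: continuous_in_subspaceT => t /set_mem/= tab.
apply: speed_continuous; have : \forall s \near t, U s.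
  by apply: open_nbhs_nbhs; split; [exact: oU|exact: sU].
by apply: filterS => s; exact: Cc.
Qed.

Lemma pwC1_ext c c' a b : pwC1 c a b -> (forall t, t \in `[a, b] -> c t = c' t) ->
  pwC1 c' a b /\ arc_len c' a b = arc_len c a b.
Proof.
elim=> [{}a|{}a x {}b ax [U [d [oU sU Cd e]]] pc IH] ecc'.
  by split; [exact: pwC1_nil|rewrite !len_nil].
have xb := pwC1_le pc.
have [|pc' lc'] := IH.
  move=> t txb; apply: ecc'; move: t txb; apply: subset_itvr.
  by rewrite bnd_simp ltW.
have e' t : t \in `[a, x] -> c' t = d t.
  move=> tax; rewrite -(e t tax); apply/esym/ecc'; move: t tax; apply: subset_itvl.
  by rewrite bnd_simp.
have P1 : pwC1 c' a b.
  exact: (pwC1_cons ax (ex_intro _ U (ex_intro _ d (And4 oU sU Cd e'))) pc').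
have P2 : pwC1 c a b.
  exact: (pwC1_cons ax (ex_intro _ U (ex_intro _ d (And4 oU sU Cd e))) pc).
split; first exact: P1.
rewrite (len_cat (ltW ax) xb (pwC1_meas P1)) (len_cat (ltW ax) xb (pwC1_meas P2)).
by rewrite lc' (C1_piece_len sU oU Cd e).1 (C1_piece_len sU oU Cd e').1.
Qed.

End Lengths.

Section Distance.
Context {R : realType} {M : ptopologicalType} {n : nat}.
Variable A : riemannianManifold R M n.
Implicit Types (c : R -> M) (a b t : R) (g : M -> M).
Notation mu := (@lebesgue_measure R).

Lemma affine_continuous (k m : R) : continuous (fun t : R => k * t + m).
Proof.
move=> t; apply: differentiable_continuous; apply/derivable1_diffP.
by apply: derivableD => //; apply: derivableM.
Qed.

(** The length is invariant under reparametrization; here and for [pwC1_rev],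
    by a change of variable on each piece. *)
Lemma pwC1_affine c (k m : R) a b : 0 < k -> pwC1 A c a b ->
  pwC1 A (fun t => c (k * t + m)) ((a - m) / k) ((b - m) / k) /\
  arc_len A (fun t => c (k * t + m)) ((a - m) / k) ((b - m) / k) = arc_len A c a b.
Proof.
move=> k0; pose inv (x : R) := (x - m) / k; rewrite -![(_ - m) / k]/(inv _).
have invK x : k * inv x + m = x by rewrite /inv mulrC divfK ?gt_eqF// subrK.
have inv_lt x y : (inv x < inv y) = (x < y).
  by rewrite /inv ltr_pM2r ?invr_gt0// ltrD2r.
have inv_le x y : (inv x <= inv y) = (x <= y).
  by rewrite /inv ler_pM2r ?invr_gt0// lerD2r.
elim=> [{}a|{}a x {}b ax [U [d [oU sU Cd e]]] pc [IHp IHl]].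
  by split; [exact: pwC1_nil|rewrite !len_nil].
have xb := pwC1_le pc.
pose h (t : R) := k * t + m.
have h_in t y z : t \in `[inv y, inv z] -> h t \in `[y, z].
  have ht : inv (h t) = t by rewrite /h /inv addrK mulrAC divff ?mul1r ?gt_eqF.
  by rewrite -{1}ht !in_itv/= !inv_le.
pose V := h @^-1` U.
have ch : continuous h by exact: affine_continuous.
have oV : open V by have /continuousP := ch; apply.
have sV : `[inv a, inv x] `<=` V by move=> t /h_in; exact: sU.
have CV t : V t -> C1_at A (d \o h) t.
  by move=> Vt; apply: C1_at_affine; exact: Cd.
have eV t : t \in `[inv a, inv x] -> (c \o h) t = (d \o h) t.
  by move=> /h_in; exact: e.
have axi : inv a < inv x by rewrite inv_lt.
have P1 : pwC1 A (c \o h) (inv a) (inv b).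
  exact: (pwC1_cons axi (ex_intro _ V (ex_intro _ (d \o h) (And4 oV sV CV eV))) IHp).
have P2 : pwC1 A c a b.
  exact: (pwC1_cons ax (ex_intro _ U (ex_intro _ d (And4 oU sU Cd e))) pc).
split; first exact: P1.
have xbi : inv x <= inv b by rewrite inv_le.
change (arc_len A (c \o h) (inv a) (inv b) = arc_len A c a b).
rewrite (len_cat (ltW axi) xbi (pwC1_meas P1)).
rewrite (len_cat (ltW ax) xb (pwC1_meas P2)).
have IHl' : arc_len A (c \o h) (inv x) (inv b) = arc_len A c x b := IHl.
rewrite IHl'; suff -> : arc_len A (c \o h) (inv a) (inv x) = arc_len A c a x by [].
have [-> _] := C1_piece_len sV oV CV eV.
have [-> cG] := C1_piece_len sU oU Cd e.
have dh t : derivable h t 1 by apply: derivableD => //; apply: derivableM.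
have h1 : h^`()%classic = cst k by apply/funext => t; exact: derive1_affine.
have := @integration_by_substitution_increasing R h (speed A d) (inv a) (inv x).
rewrite /h !invK -/h h1 /arc_len => ->; first last.
- exact: cG.
- split=> [t _||]; first exact: dh.
    by apply: cvg_at_right_filter; exact: affine_continuous.
  by apply: cvg_at_left_filter; exact: affine_continuous.
- exact: is_cvg_cst.
- exact: is_cvg_cst.
- by move=> t _; exact: cvg_cst.
- by move=> t s _ _ ts; rewrite /h ltrD2r ltr_pM2l.
- exact: ltW.
apply: eq_integral => t /set_mem/= tax; congr (_%:E).
have es : speed A (d \o h) t = `|k| * speed A d (h t).
  exact: (speed_affine (Cd _ (sV _ tax))).
by apply: (etrans es); rewrite (gtr0_norm k0); exact: mulrC.
Qed.

Lemma pwC1_rev c a b : pwC1 A c a b ->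
  pwC1 A (fun t => c (- t)) (- b) (- a) /\
  arc_len A (fun t => c (- t)) (- b) (- a) = arc_len A c a b.
Proof.
(* The reflection is written as an affine map in order to use [C1_at_affine] and
   [speed_affine]. *)
pose h (t : R) := -1 * t + 0.
have hE t : h t = - t by rewrite /h addr0 mulN1r.
have -> : (fun t => c (- t)) = c \o h by apply/funext => t /=; rewrite hE.
elim=> [{}a|{}a x {}b ax [U [d [oU sU Cd e]]] pc [IHp IHl]].
  by split; [exact: pwC1_nil|rewrite !len_nil].
have xb := pwC1_le pc.
have h_in t y z : t \in `[- y, - z] -> h t \in `[z, y].
  by rewrite hE !in_itv/= lerNl andbC lerNr.
pose V := h @^-1` U.
have ch : continuous h by exact: affine_continuous.
have oV : open V by have /continuousP := ch; apply.
have sV : `[- x, - a] `<=` V by move=> t /h_in; exact: sU.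
have CV t : V t -> C1_at A (d \o h) t.
  by move=> Vt; apply: C1_at_affine; exact: Cd.
have eV t : t \in `[- x, - a] -> (c \o h) t = (d \o h) t.
  by move=> /h_in; exact: e.
have axi : - x < - a by rewrite ltrN2.
have P1 : pwC1 A (c \o h) (- b) (- a).
  apply: (pwC1_cat IHp).
  exact: (pwC1_cons axi (ex_intro _ V (ex_intro _ (d \o h) (And4 oV sV CV eV))) (pwC1_nil _ _ _)).
have P2 : pwC1 A c a b.
  exact: (pwC1_cons ax (ex_intro _ U (ex_intro _ d (And4 oU sU Cd e))) pc).
split; first exact: P1.
have bx : - b <= - x by rewrite lerN2.
rewrite (len_cat bx (ltW axi) (pwC1_meas P1)) IHl.
rewrite (len_cat (ltW ax) xb (pwC1_meas P2)) addeC.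
suff -> : arc_len A (c \o h) (- x) (- a) = arc_len A c a x by [].
have [-> _] := C1_piece_len sV oV CV eV.
have [-> cG] := C1_piece_len sU oU Cd e.
have := @integration_by_substitution_oppr R (speed A d) (- x) (- a) (ltW axi).
rewrite !opprK => /(_ cG) E; rewrite /arc_len E.
have es t : V t -> speed A (d \o h) t = (speed A d \o -%R) t.
  move=> Vt; have es : speed A (d \o h) t = `|-1| * speed A d (h t).
    exact: (speed_affine (Cd _ Vt)).
  by apply: (etrans es); rewrite normrN1 mul1r hE.
by apply: eq_integral => t /set_mem/sV/es ->.
Qed.

Lemma pwC1_map g c a b (L : R) : C1_map A g -> 0 <= L -> (normD A g <= L%:E)%E ->
  pwC1 A c a b ->
  pwC1 A (g \o c) a b /\ (arc_len A (g \o c) a b <= L%:E * arc_len A c a b)%E.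
Proof.
move=> Cg L0 gL.
elim=> [{}a|{}a x {}b ax Cax pc [IHp IHl]].
  by split; [exact: pwC1_nil|rewrite !len_nil mule0].
have [U [d [oU sU Cd e]]] := Cax.
have xb := pwC1_le pc.
have Cgd t : U t -> C1_at A (g \o d) t by move=> /Cd; exact: C1_at_map.
have eg t : t \in `[a, x] -> (g \o c) t = (g \o d) t by move=> /e /= ->.
have P1 : pwC1 A (g \o c) a b.
  exact: (pwC1_cons ax (ex_intro _ U (ex_intro _ (g \o d) (And4 oU sU Cgd eg))) IHp).
have P2 : pwC1 A c a b by exact: (pwC1_cons ax Cax pc).
split; first exact: P1.
rewrite (len_cat (ltW ax) xb (pwC1_meas P1)) (len_cat (ltW ax) xb (pwC1_meas P2)).
rewrite ge0_muleDr ?len_ge0//; apply: leeD => //.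
have [-> _] := C1_piece_len sU oU Cgd eg.
have [-> _] := C1_piece_len sU oU Cd e.
have md : measurable_fun `[a, x] (speed A d).
  by apply: C1_piece_meas; exists U, d; split.
have mgd : measurable_fun `[a, x] (speed A (g \o d)).
  by apply: C1_piece_meas; exists U, (g \o d); split.
have ->  : (L%:E * arc_len A d a x =
    \int[mu]_(t in `[a, x]) (L%:E * (speed A d t)%:E))%E.
  have Esp : measurable_fun `[a, x] (EFin \o speed A d).
    by apply/measurable_EFinP; exact: md.
  have s0 t : `[a, x]%classic t -> (0 <= (EFin \o speed A d) t)%E.
    by move=> _; exact: speed_ge0.
  by rewrite -(ge0_integralZl mu (measurable_itv _) Esp s0).
apply: ge0_le_integral.
- exact: measurable_itv.
- by move=> t _; exact: speed_ge0.
- by apply/measurable_EFinP; exact: mgd.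
- apply/measurable_EFinP.
  exact: (measurable_funM (@measurable_cst _ _ _ _ _ L) md).
move=> t tax; rewrite -EFinM lee_fin; apply: (speed_map Cg gL).
by apply: Cd; exact: sU.
Qed.

End Distance.

(** * The Riemannian distance *)

Section Metric.
Context {R : realType} {M : ptopologicalType} {n : nat}.
Variable A : riemannianManifold R M n.
Implicit Types (c : R -> M) (g : M -> M) (x y z : M).
Notation mu := (@lebesgue_measure R).

Lemma rdist_le_len c : pwC1 A c 0 1 -> (rdist A (c 0%R) (c 1%R) <= arc_len A c 0 1)%E.
Proof. by move=> /pwC1P pc; apply: ereal_inf_lbound; exists c. Qed.

Lemma rdist_lb x y (l : \bar R) :
  (forall c, pwC1 A c 0 1 -> c 0 = x -> c 1 = y -> (l <= arc_len A c 0 1)%E) ->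
  (l <= rdist A x y)%E.
Proof. by move=> H; apply/ereal_infP => _ [c [/pwC1P pc c0 c1] <-]; exact: H. Qed.

Lemma rdist_ge0 x y : (0 <= rdist A x y)%E.
Proof. by apply: rdist_lb => c _ _ _; exact: len_ge0. Qed.

Lemma rdist_refl x : rdist A x x = 0%E.
Proof.
apply/eqP; rewrite eq_le rdist_ge0 andbT.
have C : C1_piece A (cst x) 0 1.
  by exists setT, (cst x); split=> //; [exact: openT|move=> t _; exact: C1_at_cst].
have P : pwC1 A (cst x) 0 1 by exact: (pwC1_cons ltr01 C (pwC1_nil _ _ _)).
have := rdist_le_len P; rewrite /arc_len.
by under eq_integral do rewrite speed_cst; rewrite integral0.
Qed.

Lemma rdist_sym_le x y : (rdist A x y <= rdist A y x)%E.
Proof.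
apply: rdist_lb => c pc c0 c1.
have [p1 l1] := pwC1_rev pc.
have [p2 l2] := pwC1_affine (-1) ltr01 p1.
move: l1 p2 l2; rewrite !divr1 !opprK addNr oppr0 add0r => l1 p2 l2.
by rewrite -l1 -l2 -c0 -c1; have := rdist_le_len p2; rewrite /= mulr0 mulr1 addrN oppr0 add0r opprK.
Qed.

Lemma rdist_sym x y : rdist A x y = rdist A y x.
Proof. by apply/eqP; rewrite eq_le !rdist_sym_le. Qed.

(** Both curves are run at double speed, one on [[0, 1/2]] and the other one on
    [[1/2, 1]]. *)
Lemma rdist_cat c1 c2 : pwC1 A c1 0 1 -> pwC1 A c2 0 1 -> c1 1 = c2 0 ->
  (rdist A (c1 0%R) (c2 1%R) <= arc_len A c1 0 1 + arc_len A c2 0 1)%E.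
Proof.
move=> P1 P2 e.
have [p1 l1] := pwC1_affine 0 (ltr0n R 2) P1.
have [p2 l2] := pwC1_affine (-1) (ltr0n R 2) P2.
have h1 : (0 - 0) / 2 = 0 :> R by rewrite subr0 mul0r.
have h2 : (1 - 0) / 2 = 2^-1 :> R by rewrite subr0 mul1r.
have h3 : (0 - -1) / 2 = 2^-1 :> R by rewrite sub0r opprK mul1r.
have h4 : (1 - -1) / 2 = 1 :> R by rewrite opprK divff// pnatr_eq0.
have h5 : 2 * 2^-1 = 1 :> R by rewrite divff// pnatr_eq0.
rewrite h1 h2 in p1 l1; rewrite h3 h4 in p2 l2.
pose c (t : R) := if t <= 2^-1 then c1 (2 * t + 0) else c2 (2 * t + -1).
have e1 (t : R) : t \in `[0, 2^-1] -> c1 (2 * t + 0) = c t.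
  by rewrite /c in_itv/= => /andP[_ ->].
have e2 (t : R) : t \in `[2^-1, 1] -> c2 (2 * t + -1) = c t.
  rewrite /c in_itv/= => /andP[t2 _]; case: ifPn => [t2'|_]; last by [].
  have -> : t = 2^-1 by apply/eqP; rewrite eq_le t2 t2'.
  by rewrite !h5 subrr addr0.
have [q1 k1] := pwC1_ext p1 e1.
have [q2 k2] := pwC1_ext p2 e2.
have q := pwC1_cat q1 q2.
have := rdist_le_len q; rewrite (len_cat (pwC1_le q1) (pwC1_le q2) (pwC1_meas q)).
rewrite k1 k2 l1 l2.
have h6 : (2^-1 : R) <= 1 by rewrite (invf_le1 (ltr0n R 2)); exact: ler1n.
have h7 : 0 <= (2^-1 : R) by rewrite invr_ge0.
have E0 : c1 0 = c 0.
  have i0 : (0 : R) \in `[0, 2^-1] by rewrite in_itv/= lexx.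
  by have := e1 _ i0; rewrite mulr0 addr0.
have E1 : c2 1 = c 1.
  have i1 : (1 : R) \in `[2^-1, 1] by rewrite in_itv/= lexx andbT.
  by have := e2 _ i1; rewrite mulr1 -[2]/(1 + 1) addrK.
by rewrite E0 E1.
Qed.

Lemma rdist_triangle x y z : (rdist A x z <= rdist A x y + rdist A y z)%E.
Proof.
have [->|yxy] := eqVneq (rdist A x y) +oo%E; first by rewrite addye ?leey// gt_eqF// (lt_le_trans _ (rdist_ge0 _ _)).
have [->|yyz] := eqVneq (rdist A y z) +oo%E; first by rewrite addey ?leey// gt_eqF// (lt_le_trans _ (rdist_ge0 _ _)).
have fxy : rdist A x y \is a fin_num by rewrite ge0_fin_numE ?rdist_ge0// lt_neqAle yxy leey.
have fyz : rdist A y z \is a fin_num by rewrite ge0_fin_numE ?rdist_ge0// lt_neqAle yyz leey.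
apply/lee_addgt0Pr => e e0.
have e20 : 0 < e / 2 by rewrite divr_gt0.
have [_ [c1 [/pwC1P P1 c10 c11] <-] l1] := lb_ereal_inf_adherent e20 fxy.
have [_ [c2 [/pwC1P P2 c20 c21] <-] l2] := lb_ereal_inf_adherent e20 fyz.
have l := rdist_cat P1 P2 (etrans c11 (esym c20)).
rewrite c10 c21 in l; apply: (le_trans l).
apply: (le_trans (leeD (ltW l1) (ltW l2))).
by rewrite addeACA -EFinD -splitr.
Qed.

Lemma rdist_map g (L : R) x y : C1_map A g -> 0 < L -> (normD A g <= L%:E)%E ->
  (rdist A (g x) (g y) <= L%:E * rdist A x y)%E.
Proof.
move=> Cg L0 gL; rewrite -lee_pdivrMl//; apply: rdist_lb => c pc c0 c1.
rewrite lee_pdivrMl// -c0 -c1.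
have [pgc lgc] := pwC1_map Cg (ltW L0) gL pc.
exact: le_trans (rdist_le_len pgc) lgc.
Qed.

Lemma entry_le_norm (p q : nat) (B : 'M[R]_(p, q)) i j : `|B i j| <= `|B|.
Proof.
rewrite [leRHS]/Num.norm/= mx_normrE.
exact: (le_bigmax _ (fun ij : 'I_p * 'I_q => `|B ij.1 ij.2|) (i, j)).
Qed.

Lemma quad_form_bound (B : 'M[R]_n) (w : 'rV[R]_n) :
  (w *m B *m w^T) 0 0 <= (n * n)%:R * `|B| * `|w| ^+ 2.
Proof.
have step : (w *m B *m w^T) 0 0 <= \sum_(k < n) \sum_(l < n) `|B| * `|w| ^+ 2.
  rewrite mxE; apply: ler_sum => k _; rewrite !mxE mulr_suml.
  apply: ler_sum => l _; apply: (le_trans (ler_norm _)); rewrite !normrM.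
  rewrite mulrAC mulrC expr2; apply: ler_pM; rewrite ?mulr_ge0 ?entry_le_norm//.
  by apply: ler_pM; rewrite ?entry_le_norm.
apply: (le_trans step).
by rewrite !sumr_const !card_ord -mulrA -mulrnA mulr_natl.
Qed.

(** In a chart around [x] the Gram matrices are bounded near the image of [x], so
    the length of a short segment is at most a constant times its norm. *)
Lemma rdist_near x (e : R) : 0 < e -> \forall y \near x, (rdist A x y < e%:E)%E.
Proof.
move=> e0; set i := chart_at A x; set u := phi i x.
have dx : dom i x by exact: chart_atP.
have uO : (phi i @` dom i) u by exists x.
pose K := `|gram i u| + 1; pose C := (n * n)%:R * K.
have K0 : 0 <= K by rewrite addr_ge0.
have C0 : 0 <= C by rewrite mulr_ge0.
have ng : \forall v \near u, `|gram i v| <= K.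
  have cn : {for u, continuous (fun v => `|gram i v|)}.
    exact: (cvg_comp _ _ (gram_continuous uO) (@norm_continuous _ _ (gram i u))).
  have nK : \forall r \near `|gram i u|, r < K by apply: lt_nbhsl; rewrite ltrDl.
  have := @near_comp _ _ _ u (fun r : R => r < K) cn nK.
  by apply: filterS => v; exact: ltW.
have nO : \forall v \near u, (phi i @` dom i) v.
  by apply: open_nbhs_nbhs; split; [exact: open_codom|exact: uO].
have /nbhs_ballP[r /= r0 rb] : \forall v \near u,
  (phi i @` dom i) v /\ `|gram i v| <= K by apply: filterI.
pose rho := Num.min r (e / (Num.sqrt C + 1)).
have sC : 0 < Num.sqrt C + 1 by rewrite ltr_wpDl ?sqrtr_ge0.
have rho0 : 0 < rho by rewrite lt_min r0 divr_gt0.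
have nphi : \forall y \near x, ball u rho (phi i y).
  apply: (@near_comp _ _ _ x (ball u rho) (phi_continuous dx)).
  exact: nbhsx_ballx.
have nd : \forall y \near x, dom i y by exact: chart_nbhs.
near=> y.
have dy : dom i y by near: y.
have by_ : ball u rho (phi i y) by near: y.
pose w := phi i y - u.
have wr : `|w| < rho by move: by_; rewrite -ball_normE/= distrC.
have inr t : t \in `[0, 1] -> ball u r (u + t *: w).
  rewrite in_itv/= => /andP[t0 t1]; rewrite -ball_normE/= opprD addNKr normrN.
  rewrite normrZ ger0_norm//; apply: (@le_lt_trans _ _ `|w|).
    by rewrite ler_piMl.
  by apply: (lt_le_trans wr); rewrite ge_min lexx.
pose l (t : R) := u + t *: w; pose c t := psi i (l t).
pose U := l @^-1` (phi i @` dom i).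
have cl : continuous l.
  move=> t; apply: cvgD; first exact: cvg_cst.
  apply: cvgZr_tmp; exact: cvg_id.
have oU : open U.
  by have /continuousP := cl; apply; exact: open_codom.
have sU : `[0, 1] `<=` U by move=> t /inr/rb[].
have CU t : U t -> C1_at A c t by move=> Ut; have [] := C1_at_segment Ut.
have ce t : t \in `[0, 1] -> c t = c t by [].
have P : pwC1 A c 0 1.
  exact: (pwC1_cons ltr01 (ex_intro _ U (ex_intro _ c (And4 oU sU CU ce))) (pwC1_nil _ _ _)).
have c0 : c 0 = x by rewrite /c /l scale0r addr0 phiK.
have c1 : c 1 = y by rewrite /c /l scale1r /w addrC subrK phiK.
have := rdist_le_len P; rewrite c0 c1 => /le_lt_trans; apply.
apply: (@le_lt_trans _ _ (Num.sqrt C * `|w|)%:E); last first.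
  rewrite lte_fin; apply: (@le_lt_trans _ _ ((Num.sqrt C + 1) * `|w|)).
    by rewrite ler_wpM2r// lerDl.
  rewrite mulrC -ltr_pdivlMr//; apply: (lt_le_trans wr).
  by rewrite ge_min lexx orbT.
have -> : (Num.sqrt C * `|w|)%:E =
    (\int[mu]_(t in `[0%R, 1%R]) cst (Num.sqrt C * `|w|)%:E t)%E.
  rewrite integral_cst; last exact: measurable_itv.
  have := @lebesgue_measure_itv R `[0, 1].
  by rewrite /= lte_fin ltr01 sube0 => ->; rewrite mule1.
apply: ge0_le_integral.
- exact: measurable_itv.
- by move=> t _; exact: speed_ge0.
- by apply/measurable_EFinP; exact: (pwC1_meas P).
- exact: measurable_cst.
move=> t t01; rewrite lee_fin.
have [Ot gt] := rb _ (inr _ t01).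
have [_ ->] := C1_at_segment Ot.
have ew : `|w| = Num.sqrt (`|w| ^+ 2) by rewrite sqrtr_sqr normr_id.
rewrite ew -sqrtrM// ler_wsqrtr//.
apply: (le_trans (quad_form_bound _ _)).
by rewrite ler_wpM2r ?sqr_ge0// ler_wpM2l.
Unshelve. all: by end_near. Qed.

End Metric.

(** * Upper limits and monotone limits *)

Section LimSup.
Context {R : realType}.
Implicit Types (u : (\bar R)^nat) (b : \bar R).
Local Open Scope ereal_scope.

Lemma limn_esup_lt u b : limn_esup u < b -> \forall k \near \oo, u k < b.
Proof.
rewrite limn_esup_lim (cvg_lim _ (@cvg_esups_inf R u))//.
move=> /ereal_inf_lt[_ [N _ <-] ub]; exists N => // k Nk.
by apply: le_lt_trans ub; apply: ereal_sup_ubound; exists k.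
Qed.

Lemma limn_esup_gt u b : b < limn_esup u -> forall N, exists2 k, (N <= k)%N & b < u k.
Proof.
rewrite limn_esup_lim (cvg_lim _ (@cvg_esups_inf R u))// => bu N.
have : b < esups u N.
  by apply: (lt_le_trans bu); apply: ereal_inf_lbound; exists N.
by move=> /ereal_sup_gt[_ [k /= Nk <-] bk]; exists k.
Qed.

Lemma limn_esup_mono u v : (forall k, u k <= v k) -> limn_esup u <= limn_esup v.
Proof.
move=> uv; rewrite !limn_esup_lim; apply: lee_lim; [exact: is_cvg_esups..|].
apply: nearW => k; apply: ge_ereal_sup => _ [j /= kj <-].
by apply: (le_trans (uv j)); apply: ereal_sup_ubound; exists j.
Qed.

Lemma limn_esup_ge0 u : (forall k, 0 <= u k) -> 0 <= limn_esup u.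
Proof.
move=> u0; rewrite limn_esup_lim; apply: lime_ge; first exact: is_cvg_esups.
apply: nearW => k; apply: (le_trans (u0 k)); apply: ereal_sup_ubound.
by exists k => /=.
Qed.

Let in0y (x : \bar R) : 0 <= x -> x \in `[0, +oo].
Proof. by move=> x0; rewrite in_itv/= x0 leey. Qed.

Lemma scaled_lne_mono k (x y : \bar R) : 0 <= x -> x <= y ->
  (k%:R^-1)%:E * lne x <= (k%:R^-1)%:E * lne y.
Proof.
move=> x0 xy; apply: lee_wpmul2l; first by rewrite lee_fin invr_ge0.
by rewrite lee_lne// in0y// (le_trans x0 xy).
Qed.

Lemma lt_scaled_lne k (c : R) (x : \bar R) : (0 < k)%N -> 0 <= x ->
  c%:E < (k%:R^-1)%:E * lne x -> (expR (c * k%:R))%:E < x.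
Proof.
move=> k0 x0; apply: contraTT; rewrite -!leNgt => xe.
rewrite lee_pdivrMl ?ltr0n//.
have -> : k%:R%:E * c%:E = lne (expR (c * k%:R))%:E.
  by rewrite lne_EFin ?expR_gt0// expRK -EFinM mulrC.
by rewrite lee_lne// in0y// lee_fin expR_ge0.
Qed.

Lemma scaled_lne_lt k (c : R) (x : \bar R) : (0 < k)%N -> 0 <= x ->
  (k%:R^-1)%:E * lne x < c%:E -> x < (expR (c * k%:R))%:E.
Proof.
move=> k0 x0; apply: contraTT; rewrite -!leNgt => xe.
rewrite lee_pdivlMl ?ltr0n//.
have -> : k%:R%:E * c%:E = lne (expR (c * k%:R))%:E.
  by rewrite lne_EFin ?expR_gt0// expRK -EFinM mulrC.
by rewrite lee_lne// in0y// lee_fin expR_ge0.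
Qed.

Lemma lim_at_right_ge (f : R -> \bar R) (d : R) : (0 < d)%R ->
  (forall x y, (0 < x)%R -> (x <= y)%R -> f y <= f x) ->
  f d <= lim (f e @[e --> (0%R)^'+]).
Proof.
move=> d0 mf.
have := @nonincreasing_at_right_cvge R f 0%R +oo%O.
have Hh : {in `]0%R, +oo[ &, {homo f : n m / (n <= m)%R >-> (m <= n)%E}}.
  by move=> x y; rewrite !in_itv/= !andbT => x0 y0; exact: mf.
move=> /(_ _ Hh) H; have -> := cvg_lim _ (H _) => //.
by apply: ereal_sup_ubound; exists d => //=; rewrite in_itv/= d0.
Qed.

Lemma lim_at_right_gt (f : R -> \bar R) b :
  (forall x y, (0 < x)%R -> (x <= y)%R -> f y <= f x) ->
  b < lim (f e @[e --> (0%R)^'+]) -> exists2 d : R, (0 < d)%R & b < f d.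
Proof.
move=> mf.
have := @nonincreasing_at_right_cvge R f 0%R +oo%O.
have Hh : {in `]0%R, +oo[ &, {homo f : n m / (n <= m)%R >-> (m <= n)%E}}.
  by move=> x y; rewrite !in_itv/= !andbT => x0 y0; exact: mf.
move=> /(_ _ Hh) H; have -> := cvg_lim _ (H _) => //.
move=> /ereal_sup_gt[_ [d /= + <-] bd]; rewrite in_itv/= andbT => d0.
by exists d.
Qed.

Lemma lim_at_left_ge (f : R -> \bar R) (a s : R) :
  {homo f : x y / (x <= y)%R >-> x <= y} -> (s < a)%R ->
  f s <= lim (f s @[s --> a^'-]).
Proof.
move=> mf sa.
have := @nonincreasing_at_right_cvge R (f \o -%R) (- a)%R +oo%O.
have Hh : {in `](- a)%R, +oo[ &, {homo f \o -%R : n m / (n <= m)%R >-> (m <= n)%E}}.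
  by move=> x y _ _ xy; apply: mf; rewrite lerN2.
move=> /(_ isT Hh)/cvg_at_leftNP H; rewrite (cvg_lim _ H)//.
apply: ereal_sup_ubound; exists (- s)%R; rewrite /= ?opprK//.
by rewrite in_itv/= ltrN2 sa.
Qed.

End LimSup.

(** * Spanning and separated sets *)

Section Spanning.
Context {R : realType} {M : ptopologicalType} {n : nat}.
Variable A : riemannianManifold R M n.
Implicit Types (x y z : M) (f g : M -> M) (k : nat) (e d : R) (L : set M).
Local Open Scope ereal_scope.

Lemma dyn_close_refl k g e x : (0 < e)%R -> dyn_close A k g e x x.
Proof. by move=> e0 i _; rewrite rdist_refl lte_fin. Qed.

Lemma dyn_close_sym k g e x y : dyn_close A k g e x y -> dyn_close A k g e y x.
Proof. by move=> H i ik; rewrite rdist_sym; exact: H. Qed.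

Lemma dyn_close_trans k g e d x y z : dyn_close A k g e x y ->
  dyn_close A k g d y z -> dyn_close A k g (e + d) x z.
Proof.
move=> xy yz i ik; apply: (le_lt_trans (rdist_triangle A _ (iter i g y) _)).
by rewrite EFinD lteD// ?xy ?yz.
Qed.

Lemma dyn_close_le k g e d x y : (e <= d)%R -> dyn_close A k g e x y -> dyn_close A k g d x y.
Proof. by move=> ed H i ik; apply: (lt_le_trans (H i ik)); rewrite lee_fin. Qed.

Lemma iter_continuous g i : continuous g -> continuous (iter i g).
Proof.
move=> cg; elim: i => [|i IH] x; first exact: cvg_id.
exact: (cvg_comp _ _ (IH x) (cg _)).
Qed.

Lemma open_rdist_ball y e : open [set x | rdist A x y < e%:E].
Proof.
rewrite openE => x /= xy; rewrite /interior.
have fxy : rdist A x y \is a fin_num.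
  by rewrite ge0_fin_numE ?rdist_ge0// (lt_trans xy) ?ltry.
have d0 : (0 < e - fine (rdist A x y))%R by rewrite subr_gt0 -lte_fin fineK.
have := rdist_near A x d0; apply: filterS => z /= xz.
apply: (le_lt_trans (rdist_triangle A _ x _)).
by rewrite rdist_sym -lteBrDr// -[X in _ < _ - X]fineK.
Qed.

Lemma open_dyn_close k g e y : continuous g -> open [set x | dyn_close A k g e x y].
Proof.
move=> cg; elim: k => [|k IH].
  have -> : [set x | dyn_close A 0 g e x y] = setT by apply/seteqP; split.
  exact: openT.
have -> : [set x | dyn_close A k.+1 g e x y] = [set x | dyn_close A k g e x y] `&`
    (iter k g @^-1` [set x | rdist A x (iter k g y) < e%:E]).
  apply/seteqP; split=> x /= H; first by split=> [i ik|]; apply: H; [exact: ltnW|].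
  move=> i; rewrite ltnS leq_eqVlt => /predU1P[->|]; [exact: H.2|exact: H.1].
apply: openI => //; have /continuousP := @iter_continuous g k cg.
by apply; exact: open_rdist_ball.
Qed.

Lemma rspan_ge0 k g L d : 0 <= rspan A k g L d.
Proof. by apply/ereal_infP => _ [m _ <-]; rewrite lee_fin. Qed.

Lemma rspan_le k g L d (m : nat) (K : set M) : (K #<= `I_m)%card ->
  (forall x, L x -> exists2 y, K y & dyn_close A k g d x y) ->
  rspan A k g L d <= m%:R%:E.
Proof.
move=> Km H; have finK : finite_set K.
  by apply: card_le_finite Km _; exact: finite_II.
have [j Kj] := finK.
have jm : (j <= m)%N.
  by have /card_eqPle[_ jK] := Kj; rewrite -card_le_II; exact: card_le_trans jK Km.
apply: (@le_trans _ _ (j%:R%:E)); last by rewrite lee_fin ler_nat.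
by apply: ereal_inf_lbound; exists j => //; exists K.
Qed.

(** The infimum in the definition of [rspan] is attained, being taken over
    natural numbers. *)
Lemma rspan_nat k g L d : rspan A k g L d < +oo -> exists m : nat, exists K : set M,
  [/\ rspan A k g L d = m%:R%:E, (K #= `I_m)%card &
   forall x, L x -> exists2 y, K y & dyn_close A k g d x y].
Proof.
pose P m := `[< exists K : set M, (K #= `I_m)%card /\
  forall x, L x -> exists2 y, K y & dyn_close A k g d x y >].
move=> /ereal_inf_lt[_ [m0 Pm0 _] _].
have ex : exists m, P m by exists m0; apply/asboolP.
have [m /asboolP[K [Km HK]] mmin] := ex_minnP ex.
exists m, K; split=> //; apply/eqP; rewrite eq_le; apply/andP; split.
  by apply: ereal_inf_lbound; exists m => //; exists K.
apply/ereal_infP => _ [j Pj <-]; rewrite lee_fin ler_nat; apply: mmin.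
exact/asboolP.
Qed.

Lemma rspan_anti k g L d d' : (d <= d')%R -> rspan A k g L d' <= rspan A k g L d.
Proof.
move=> dd; apply/ereal_infP => _ [m [K [Km HK]] <-].
apply: ereal_inf_lbound; exists m => //; exists K; split=> // x /HK[y Ky xy].
by exists y => //; exact: dyn_close_le xy.
Qed.

Lemma rspan_ge1 k g L d x : L x -> 1 <= rspan A k g L d.
Proof.
move=> Lx; apply/ereal_infP => _ [m [K [Km HK]] <-]; rewrite lee_fin ler1n lt0n.
apply/eqP => m0; have [y Ky _] := HK x Lx.
by move: Km; rewrite m0 II0 card_eq0 => /eqP K0; rewrite K0 in Ky.
Qed.

(** Greedy choice: as long as fewer points than the minimal number of centres
    have been chosen, they do not span, and some point is far from all of them.
    Storing the points in a function on [nat] allows any [m] below a possibly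
    infinite [rspan]. *)
Lemma separated_points k g d (m : nat) : m%:R%:E <= rspan A k g setT d ->
  exists pt : nat -> M, forall i j, (i < j < m)%N -> ~ dyn_close A k g d (pt j) (pt i).
Proof.
elim: m => [_|m IH mr]; first by exists (fun _ => point) => i j; rewrite andbF.
have [|pt sep] := IH; first by apply: le_trans mr; rewrite lee_fin ler_nat.
have [x nx] : exists x, forall i, (i < m)%N -> ~ dyn_close A k g d x (pt i).
  apply: contrapT => /forallNP H; have : rspan A k g setT d <= m%:R%:E.
    apply: (@rspan_le _ _ _ _ m (pt @` `I_m)); first exact: card_image_le.
    move=> x _; have /existsNP[i /not_implyP[im /contrapT xi]] := H x.
    by exists (pt i) => //; exists i.
  by move=> /(le_trans mr); rewrite lee_fin ler_nat ltnn.
exists (fun i => if i == m then x else pt i) => i j /andP[ij].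
rewrite ltnS => jm; have im : (i < m)%N by exact: leq_trans jm.
rewrite (ltn_eqF im); case: eqVneq => [_|jm']; first exact: nx.
by apply: sep; rewrite ij ltn_neqAle jm' jm.
Qed.

Lemma entropy_at_anti f e e' : (e <= e')%R -> entropy_at A f e' <= entropy_at A f e.
Proof.
move=> ee; apply: limn_esup_mono => k.
by apply: scaled_lne_mono; [exact: rspan_ge0|exact: rspan_anti].
Qed.

Lemma entropy_at_le f e : (0 < e)%R -> entropy_at A f e <= entropy A f.
Proof. by move=> e0; apply: lim_at_right_ge => // x y _; exact: entropy_at_anti. Qed.

Lemma entropy_at_ge0 f e : 0 <= entropy_at A f e.
Proof.
apply: limn_esup_ge0 => k; apply: mule_ge0; first by rewrite lee_fin invr_ge0.
by rewrite lne_ge0; apply: (rspan_ge1 _ _ _ (x := point)).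
Qed.

Lemma entropy_ge0 f : 0 <= entropy A f.
Proof. by apply: le_trans (entropy_at_le f ltr01); exact: entropy_at_ge0. Qed.

(** The growth rate whose limit as [d] tends to 0 is [hloc_set]. *)
Definition loc_growth g (F : set M) e d : \bar R := limn_esup (fun k : nat =>
  (k%:R^-1)%:E * lne (ereal_sup [set rspan A k g (F `&` dyn_ball A k g x e) d | x in F])).

Lemma loc_sup_ge0 g (F : set M) e d k x : F x ->
  0 <= ereal_sup [set rspan A k g (F `&` dyn_ball A k g x e) d | x in F].
Proof.
move=> Fx; apply: le_trans (rspan_ge0 k g (F `&` dyn_ball A k g x e) d) _.
by apply: ereal_sup_ubound; exists x.
Qed.

Lemma loc_growth_le g (F : set M) e d x : F x -> (0 < d)%R -> loc_growth g F e d <= hloc_set A g F e.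
Proof.
move=> Fx d0; apply: (@lim_at_right_ge R (loc_growth g F e) d d0) => s t _ st.
apply: limn_esup_mono => k; apply: scaled_lne_mono; first exact: loc_sup_ge0 Fx.
apply: ge_ereal_sup => _ [z Fz <-]; apply: (le_trans (rspan_anti _ _ _ st)).
by apply: ereal_sup_ubound; exists z.
Qed.

Lemma loc_growth_ge0 g (F : set M) e d x : F x -> (0 < e)%R -> 0 <= loc_growth g F e d.
Proof.
move=> Fx e0; apply: limn_esup_ge0 => k; apply: mule_ge0; first by rewrite lee_fin invr_ge0.
rewrite lne_ge0; apply: (@le_trans _ _ (rspan A k g (F `&` dyn_ball A k g x e) d)).
  by apply: (rspan_ge1 _ _ _ (x := x)); split=> //; exact: dyn_close_refl.
by apply: ereal_sup_ubound; exists x.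
Qed.

End Spanning.

(** * Codes of orbit segments *)

Section Codes.
Context {R : realType} {M : ptopologicalType} {n : nat}.
Variable A : riemannianManifold R M n.
Implicit Types (x y z : M) (f g : M -> M) (k : nat) (e d : R) (L : set M).

Lemma rspan_code k g L d (v : R) : (rspan A k g L d <= v%:E)%E ->
  exists (m : nat) (pt : nat -> M), m%:R <= v /\
    forall x, L x -> exists2 i, (i < m)%N & dyn_close A k g d x (pt i).
Proof.
move=> rv; have [m [K [rm Km HK]]] := rspan_nat (le_lt_trans rv (ltry v)).
move: rv; rewrite rm lee_fin => mv.
have /card_set_bijP[pt [_ _ ptK]] : (`I_m #= K)%card by rewrite card_eq_sym.
exists m, pt; split=> // x /HK[y /ptK[i im <-] xy].
by exists i.
Qed.

Lemma small_cover (compactM : compact [set: M]) d : 0 < d ->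
  exists (C : finType) (alpha : M -> C), forall x y, alpha x = alpha y -> (rdist A x y < d%:E)%E.
Proof.
move=> d0; have d20 : 0 < d / 2 by rewrite divr_gt0.
move: compactM; rewrite compact_cover => /(_ M setT (fun y => [set x | (rdist A x y < (d / 2)%:E)%E])).
case=> [y _|x _|D _ HD].
- exact: open_rdist_ball.
- by exists x => //=; rewrite rdist_refl lte_fin.
have H x : exists y : D, (rdist A x (val y) < (d / 2)%:E)%E.
  by have [y /= yD xy] := HD x I; exists [` yD]%fset.
have [alpha Ha] := choice H.
exists D, alpha => x y e; apply: (le_lt_trans (rdist_triangle A _ (val (alpha x)) _)).
rewrite (splitr d) EFinD lteD//.
by rewrite e rdist_sym.
Qed.

Lemma iterated_code (C : finType) (code : M -> C) p g d q : (0 < p)%N ->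
  (forall x z, code x = code z -> dyn_close A p g d x z) ->
  exists cq : M -> {ffun 'I_(q %/ p).+1 -> C},
    forall x z, cq x = cq z -> dyn_close A q g d x z.
Proof.
move=> p0 H; exists (fun x => [ffun j : 'I_(q %/ p).+1 => code (iter (j * p) g x)]).
move=> x z e i iq.
have ip : (i %/ p < (q %/ p).+1)%N by rewrite ltnS leq_div2r// ltnW.
have := congr1 (fun h : {ffun _ -> C} => h (Ordinal ip)) e; rewrite !ffunE /= => /H.
move=> /(_ (i %% p)%N (ltn_pmod _ p0)).
by rewrite -!iterD addnC -divn_eq.
Qed.

(** Markov's inequality: fewer than half of the values exceed twice the mean. *)
Lemma markov_card k (v : 'I_k.+1 -> nat) (N : nat) (a : R) :
  0 < a -> (\sum_s v s)%N%:R / (N * k.+1)%:R < a -> (0 < N)%N ->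
  (k.+1 <= 2 * #|finset (fun s => (v s <= Num.truncn (2 * a * N%:R))%N)|)%N.
Proof.
move=> a0 H N0; set E := finset _.
have aN0 : 0 < a * N%:R :> R by rewrite mulr_gt0// ltr0n.
have sum_lt : (\sum_s v s)%N%:R < a * N%:R * k.+1%:R :> R.
  by rewrite -mulrA -natrM -ltr_pdivrMr// ltr0n muln_gt0 N0.
have : (#|~: E| * 2 < k.+1)%N.
  rewrite -(ltr_nat R) natrM -(ltr_pM2l aN0); apply: le_lt_trans sum_lt.
  have -> : a * N%:R * (#|~: E|%:R * 2) = \sum_(s in ~: E) (2 * a * N%:R) :> R.
    by rewrite sumr_const -mulr_natr; ring.
  rewrite natr_sum [leRHS](bigID (mem (~: E)))/= -[leLHS]addr0; apply: lerD; last exact: sumr_ge0.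
  apply: ler_sum => s; rewrite !inE -ltnNge => bs; apply/ltW.
  by apply: (lt_le_trans (truncnS_gt _)); rewrite ler_nat.
have := cardsC E; rewrite card_ord => cE.
lia.
Qed.
End Codes.

(** * Local covers and measures carried by separated orbits *)

Section CodesAndMeasures.
Context {R : realType} {M : ptopologicalType} {n : nat}.
Variable A : riemannianManifold R M n.
Hypothesis compactM : compact [set: M].
Implicit Types (x y z : M) (g : M -> M) (k : nat).

Local Notation borelM := (g_sigma_algebraType (@open M)).

(** A point of [F] is first located up to a dynamical ball of radius [eta] by
    [cq], then up to one of radius [delta / 2] by a centre of a set that spans
    the part of [F] in this ball. *)
Lemma local_spans_code g (F : set M) q eta delta v (C : finType) (cq : M -> C) x0 :
  continuous g -> (forall x z, cq x = cq z -> dyn_close A q g eta x z) ->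
  F x0 -> (ereal_sup [set rspan A q g (F `&` dyn_ball A q g x eta) (delta / 2) | x in F] <= v%:E)%E ->
  exists (T : finType) (beta : M -> T) (U : set M),
    [/\ open U, F `<=` U, (#|T|%:R <= #|C|%:R * v) &
        forall x y, U x -> U y -> beta x = beta y -> dyn_close A q g delta x y].
Proof.
move=> cg cqP Fx0 supv; pose S := Num.truncn v.
have v0 : 0 <= v.
  by rewrite -lee_fin; apply: le_trans supv; exact: loc_sup_ge0 Fx0.
have ex w : exists pt : nat -> M, forall x, F x -> cq x = w ->
    exists2 i, (i < S)%N & dyn_close A q g (delta / 2) x (pt i).
  case: (pselect (exists2 z, F z & cq z = w)) => [[z Fz zw]|nz]; last first.
    by exists (fun _ => point) => x Fx xw; case: nz; exists x.
  have : (rspan A q g (F `&` dyn_ball A q g z eta) (delta / 2) <= v%:E)%E.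
    by apply: le_trans supv; apply: ereal_sup_ubound; exists z.
  move=> /rspan_code[m [pt [mv Hpt]]]; exists pt => x Fx xw.
  have [|i im xi] := Hpt x; first by split=> //; apply: cqP; rewrite xw.
  by exists i => //; apply: (leq_trans im); rewrite truncn_ge_nat.
have [pt Hpt] := choice ex.
have [i0 i0S _] := Hpt _ _ Fx0 erefl.
pose T : finType := (C * 'I_S)%type.
pose V (t : T) := [set x | dyn_close A q g (delta / 2) x (pt t.1 t.2)].
pose U := \bigcup_(t in [set: T]) V t.
have exb x : exists t : T, U x -> V t x.
  case: (pselect (U x)) => [[t _ Vt]|nU]; first by exists t.
  by exists (cq x0, Ordinal i0S).
have [beta Hb] := choice exb.
exists T, beta, U; split.
- by apply: bigcup_open => t _; exact: open_dyn_close.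
- by move=> x Fx; have [i iS xi] := Hpt _ _ Fx erefl; exists (cq x, Ordinal iS).
- by rewrite card_prod natrM card_ord ler_wpM2l// truncn_le.
- move=> x y /Hb Vx /Hb Vy e; rewrite (splitr delta).
  apply: (dyn_close_trans Vx); apply: dyn_close_sym; rewrite e; exact: Vy.
Qed.

(** The measure is generated by a limit of empirical measures of separated sets
    of more than [expR (c * k)] points. The ultrafilter contains the set of
    lengths for which such a separated set exists, so that what holds in the
    limit holds for some of these lengths; for the others the empirical measure
    is arbitrary. *)
Lemma separated_orbits_measure g (c delta : R) : continuous g ->
  (c%:E < entropy_at A g delta)%E ->
  exists mu : probability borelM R, invariant_measure g mu /\
    forall (U : set M) (s : R) (N : nat), open U -> (s%:E < mu U)%E ->
    exists k, exists j, exists pt : 'I_j.+1 -> M,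
      [/\ (N <= k)%N, expR (c * k.+1%:R) < j.+1%:R,
          (forall a b, dyn_close A k.+1 g delta (pt a) (pt b) -> a = b) &
          empirical_val g k pt (~` U) < 1 - s :> R].
Proof.
move=> cg cent.
pose P k := ((expR (c * k.+1%:R))%:E < rspan A k.+1 g setT delta)%E.
have Pinf N : exists2 k, (N <= k)%N & P k.
  have [[|k] // Nk ck] := limn_esup_gt cent N.+1.
  exists k; first by rewrite -ltnS.
  exact: (lt_scaled_lne (ltn0Sn k) (rspan_ge0 _ _ _ _ _) ck).
have data k : exists jp : {j : nat & 'I_j.+1 -> M}, P k ->
    expR (c * k.+1%:R) < (projT1 jp).+1%:R /\
    forall a b, dyn_close A k.+1 g delta (projT2 jp a) (projT2 jp b) -> a = b.
  case: (pselect (P k)) => [Pk|nP]; last by exists (existT _ 0%N (fun _ => point)).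
  have [j [ej jr]] : exists j : nat, expR (c * k.+1%:R) < j.+1%:R :> R /\
      ((j.+1%:R)%:E <= rspan A k.+1 g setT delta)%E.
    have [r_fin|] := ltP (rspan A k.+1 g setT delta) +oo%E; last first.
      by rewrite leye_eq => /eqP ->; exists (Num.truncn (expR (c * k.+1%:R)));
        split; [exact: truncnS_gt|rewrite leey].
    have [m [_ [rm _ _]]] := rspan_nat r_fin.
    move: Pk; rewrite /P rm lte_fin; case: m rm => [|j] rm; first by rewrite ltNge expR_ge0.
    by move=> ej; exists j.
  have [pt sep] := separated_points jr.
  exists (existT _ j (fun a : 'I_j.+1 => pt a)) => _; split=> //= a b ab.
  apply/val_inj; case: (ltngtP a b) => // lt.
    by case: (sep a b _ (dyn_close_sym ab)); rewrite lt ltn_ord.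
  by case: (sep b a _ ab); rewrite lt ltn_ord.
have [jp Hjp] := choice data.
have [nu Hnu] := choice (fun k => @empirical R M g k _ (projT2 (jp k))).
(* [F] contains [P], the lengths that carry a large separated set, and all
   final segments of [nat]. *)
pose F0 := within P \oo.
have PF0 : ProperFilter F0.
  apply: Build_ProperFilter => -[N _ HN].
  by have [k Nk Pk] := Pinf N; exact: (HN k Nk Pk).
have [F [UF sF]] := ultraFilterLemma PF0.
have FP : F P by apply: sF; exists 0%N.
have Foo : F --> \oo.
  by move=> B [N _ NB]; apply: sF; exists N => // k Nk _; exact: NB.
have [m Hm] := ultralimit_fin_add_prob nu UF.
have mg B : m (g @^-1` B) = m B.
  apply: (@ultralimit_invariant R M g F nu m B UF Foo _ Hm) => k.
  by rewrite !Hnu; exact: empirical_invariant.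
have [mu muE] := regular_measure (hausdorffM A) compactM m.
exists mu; split; first exact: (regular_measure_invariant (hausdorffM A) compactM muE cg mg).
move=> U s N oU; rewrite (muE _ oU) => smu.
have smU : s < m U by rewrite -lte_fin; apply: (lt_le_trans smu); exact: inner_le_fa.
have mUc : m (~` U) < 1 - s.
  have := fa_setU m (setICr U); rewrite setUCr fa_setT => e.
  by rewrite ltrBrDr e addrC ltrD2r.
have Fnu : F [set k | nu k (~` U) < 1 - s] by exact: (cvgr_lt _ (Hm (~` U)) _ mUc).
have FN : F [set k | (N <= k)%N] by apply: Foo; exists N.
have [k [[Pk nk] Nk]] := filter_ex (filterI (filterI FP Fnu) FN).
have [ej sep] := Hjp k Pk.
by exists k, (projT1 (jp k)), (projT2 (jp k)); split=> //; rewrite -Hnu.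
Qed.
End CodesAndMeasures.

(** * Topological entropy, codes and local entropy *)

Lemma lte_real_between (R : realType) (x y : \bar R) : (x < y)%E ->
  exists r : R, (x < r%:E)%E /\ (r%:E < y)%E.
Proof.
move: x y => [x| |] [y| |]//=; rewrite ?lte_fin.
- move=> xy; exists ((x + y) / 2); rewrite !lte_fin; split; lra.
- by move=> _; exists (x + 1); rewrite lte_fin ltry ltrDl.
- by move=> _; exists (y - 1); rewrite lte_fin ltNyr gtrDl ltrN10.
- by move=> _; exists 0; rewrite ltry ltNyr.
Qed.

Lemma ln_card_bound (R : realType) (m N K r b : nat) : (0 < m)%N -> (0 < N)%N -> (0 < r)%N ->
  (m <= 2 * ((2 * N) ^ K * (2 * r) ^ b))%N ->
  ln (m%:R : R) <= ln 2 + ln (2 * N%:R) *+ K + ln (2 * r%:R) *+ b.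
Proof.
move=> m0 N0 r0 H.
have N0' : 0 < N%:R :> R by rewrite ltr0n.
have r0' : 0 < r%:R :> R by rewrite ltr0n.
have m0' : 0 < m%:R :> R by rewrite ltr0n.
have p1 : 0 < (2 * N%:R) ^+ K :> R by rewrite exprn_gt0// mulr_gt0.
have p2 : 0 < (2 * r%:R) ^+ b :> R by rewrite exprn_gt0// mulr_gt0.
rewrite -!lnXn ?mulr_gt0// -addrA -!lnM ?posrE ?mulr_gt0//.
rewrite ler_ln ?posrE ?mulr_gt0//.
by rewrite -!natrM -!natrX -!natrM ler_nat.
Qed.

(** The bounds of [entropy_le_code_local] are incompatible for large orbit
    lengths [x]: [D] is the logarithm of twice the number of balls, [B] that of
    twice the number of small cells, [lT] is ln 2, [kap] is the allowed
    proportion of times outside the balls. A quarter of the gap [gam] absorbs the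
    error in the bound on [D / q], a quarter the times outside the balls, and half
    of it the terms that do not grow with [x]. *)
Lemma growth_numerics (R : realType) (c a H gam kap B D lT q x : R) :
  gam = c - a - H -> 0 < gam -> 0 < q -> 0 <= B -> 0 <= kap ->
  8 * kap * (B + 1) <= gam -> 0 <= D -> D <= q * (a + H + gam / 4) ->
  2 * (lT + D) <= gam * x -> 0 <= x ->
  c * x < lT + D * (x / q + 1) + B * (2 * kap * x) -> False.
Proof.
move=> gE g0 q0 B0 k0 kB D0 Dq xl x0 lt.
have h1 : D * (x / q) <= x * (a + H + gam / 4).
  rewrite mulrA ler_pdivrMr// [leRHS]mulrAC mulrC -[leRHS]mulrA; exact: ler_wpM2l.
have h2 : B * (2 * kap * x) <= gam / 4 * x.
  have : B * (2 * kap) <= gam / 4 by nra.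
  by move=> h; rewrite mulrA; exact: ler_wpM2r.
have h3 : c * x = x * (a + H + gam) by rewrite gE; ring.
nra.
Qed.

Section CoreInequality.
Context {R : realType} {M : ptopologicalType} {n : nat}.
Variable A : riemannianManifold R M n.
Hypothesis compactM : compact [set: M].
Implicit Types (x y z : M) (g : M -> M) (k : nat).
Local Notation borelM := (g_sigma_algebraType (@open M)).

(** The infimum whose limit as [sigma] tends to 1 is [hloc_measure]. *)
Definition hloc_inf g (mu : probability borelM R) eta (sigma : R) : \bar R :=
  ereal_inf [set hloc_set A g F eta |
         F in [set F : set borelM | measurable F /\ (sigma%:E <= mu F)%E]].

Lemma hloc_inf_le g mu eta sigma : sigma < 1 ->
  (hloc_inf g mu eta sigma <= hloc_measure A g mu eta)%E.
Proof.
move=> s1; apply: (@lim_at_left_ge R (hloc_inf g mu eta)) => // s t st.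
apply/ereal_infP => _ [F [mF tF] <-]; apply: ereal_inf_lbound; exists F => //.
by split=> //; apply: le_trans tF; rewrite lee_fin.
Qed.

Lemma pos_measure_nonempty (mu : probability borelM R) (F : set borelM) (s : R) :
  0 < s -> (s%:E <= mu F)%E -> exists x, F x.
Proof.
move=> s0 sF; apply: contrapT => /forallNP nF; move: sF.
have -> : F = set0 by apply/seteqP; split=> x // /nF.
by rewrite measure0 lee_fin leNgt s0.
Qed.

(** The supremum defining [hloc] is taken over a nonempty set, since [g] has an
    invariant measure. *)
Lemma hloc_ge0 g eta : continuous g -> 0 < eta -> (0 <= hloc A g eta)%E.
Proof.
move=> cg eta0.
have : ((-1)%:E < entropy_at A g 1)%E by apply: lt_le_trans (entropy_at_ge0 _ _ _); rewrite lte_fin ltrN10.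
move=> /(separated_orbits_measure compactM cg)[mu [inv _]].
apply: (@le_trans _ _ (hloc_measure A g mu eta)); last by apply: ereal_sup_ubound; exists mu.
have h1 : 2^-1 < 1 :> R by lra.
apply: le_trans (hloc_inf_le g mu eta h1).
apply/ereal_infP => _ [F [mF sF] <-].
have h0 : 0 < 2^-1 :> R by lra.
have [x Fx] := pos_measure_nonempty h0 sF.
apply: le_trans (loc_growth_le A g eta Fx ltr01); exact: (loc_growth_ge0 A g 1 Fx eta0).
Qed.

(** The heart of the proof: entropy is carried either by the code, which
    separates orbits at scale [eta], or by the dynamics inside dynamical balls of
    radius [eta], which the local entropy controls up to a set of small
    measure. *)
Lemma entropy_le_code_local g (eta : R) (p : nat) (C : finType) (code : M -> C) :
  continuous g -> 0 < eta -> (0 < p)%N ->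
  (forall x z, code x = code z -> dyn_close A p g eta x z) ->
  (entropy A g <= (p%:R^-1 * ln #|C|%:R)%:E + hloc A g eta)%E.
Proof.
move=> cg eta0 p0 codeP; rewrite leNgt; apply/negP => lt_ent.
set a := p%:R^-1 * ln #|C|%:R in lt_ent.
have [c [ac cent]] := lte_real_between lt_ent.
have C0 : (0 < #|C|)%N by apply/card_gt0P; exists (code point).
have lnC0 : 0 <= ln #|C|%:R :> R by rewrite ln_ge0// ler1n.
have hlt : (hloc A g eta < (c - a)%:E)%E.
  by move: ac; rewrite EFinB lteBrDl//.
have [H [hH Hca]] := lte_real_between hlt.
rewrite lte_fin in Hca.
have H0 : 0 <= H by rewrite -lee_fin (le_trans (hloc_ge0 cg eta0))// ltW.
have [delta delta0 cdelta] : exists2 d : R, 0 < d & (c%:E < entropy_at A g d)%E.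
  by apply: lim_at_right_gt cent => x y _; exact: entropy_at_anti.
have [T2 [alpha alphaP]] := small_cover A compactM delta0.
have T20 : (0 < #|T2|)%N by apply/card_gt0P; exists (alpha point).
pose B := ln (2 * #|T2|%:R) : R.
have B0 : 0 <= B by rewrite ln_ge0//; have : 1 <= #|T2|%:R :> R by [rewrite ler1n|]; lra.
pose gam := c - a - H.
have g0 : 0 < gam by rewrite /gam; lra.
(* The proportion of times outside the balls: small enough for its contribution
   [2 * kap * B] to stay below a quarter of the gap, whatever [q]. *)
pose kap := Num.min 1 (gam / (8 * (B + 1))).
have B10 : 0 < 8 * (B + 1) by lra.
have k0 : 0 < kap by rewrite lt_min ltr01 divr_gt0.
have k1 : kap <= 1 by rewrite ge_min lexx.
have kB : 8 * kap * (B + 1) <= gam.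
  by rewrite mulrAC mulrC -ler_pdivlMr// ge_min lexx orbT.
have [mu [mu_inv muP]] := separated_orbits_measure compactM cg cdelta.
pose sig := 1 - kap / 2.
have sig1 : sig < 1 by rewrite /sig; lra.
have sig0 : 0 < sig by rewrite /sig; lra.
have : (hloc_inf g mu eta sig < H%:E)%E.
  apply: (le_lt_trans (hloc_inf_le g mu eta sig1)); apply: le_lt_trans hH.
  by apply: ereal_sup_ubound; exists mu.
move=> /ereal_inf_lt[_ [F [mF sF] <-] FH].
have [x0 Fx0] := pos_measure_nonempty sig0 sF.
have d20 : 0 < delta / 2 by rewrite divr_gt0.
have := limn_esup_lt (le_lt_trans (loc_growth_le A g eta Fx0 d20) FH).
case=> Q _ HQ.
(* Beyond [Q] the local growth is below [H]; the last term makes the rounding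
   of [q / p] and the factor 2 of the counting bound negligible. *)
pose q := maxn (maxn Q 1) (Num.truncn (4 * (ln 2 + ln #|C|%:R) / gam : R)).+1.
have qQ : (Q <= q)%N by rewrite /q !leq_max leqnn.
have q0 : (0 < q)%N by rewrite /q !leq_max ltnS leq0n orbT.
have q0' : 0 < q%:R :> R by rewrite ltr0n.
have qln : ln 2 + ln #|C|%:R <= q%:R * (gam / 4) :> R.
  have : 4 * (ln 2 + ln #|C|%:R) / gam <= q%:R :> R.
    apply: (le_trans (ltW (truncnS_gt _))); rewrite ler_nat /q leq_max leqnn orbT.
    by [].
  by rewrite ler_pdivrMr//; lra.
have supv := scaled_lne_lt q0 (loc_sup_ge0 A g eta (delta / 2) q Fx0) (HQ q qQ).
have [cq cqP] := iterated_code q p0 codeP.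
have [T1 [beta [U [oU FU cT1 betaP]]]] := local_spans_code cg cqP Fx0 (ltW supv).
have T10 : (0 < #|T1|)%N by apply/card_gt0P; exists (beta point).
have muU : ((1 - kap)%:E < mu U)%E.
  apply: (@lt_le_trans _ _ sig%:E); first by rewrite lte_fin /sig; lra.
  apply: (le_trans sF); have mU : measurable (U : set borelM) by exact: sub_sigma_algebra.
  by apply: le_measure => //; apply/mem_set.
pose D := ln (2 * #|T1|%:R) : R.
have lnT : D <= q%:R * (a + H + gam / 4).
  have T10' : 0 < #|T1|%:R :> R by rewrite ltr0n.
  have C0' : 0 < #|C|%:R :> R by rewrite ltr0n.
  have : ln #|T1|%:R <= ln (#|C|%:R ^+ (q %/ p).+1 * expR (H * q%:R)) :> R.
    rewrite ler_ln ?posrE ?mulr_gt0 ?exprn_gt0 ?expR_gt0//.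
    by move: cT1; rewrite card_ffun card_ord natrX.
  rewrite lnM ?posrE ?exprn_gt0 ?expR_gt0// lnXn// expRK mulrS.
  rewrite /D lnM ?posrE//.
  have : ln #|C|%:R *+ (q %/ p) <= q%:R * a :> R.
    rewrite /a mulrA -[leLHS]mulr_natl ler_wpM2r// ler_pdivlMr ?ltr0n//.
    by rewrite -natrM ler_nat leq_trunc_div.
  by lra.
have D0 : 0 <= D.
  by rewrite ln_ge0//; have : 1 <= #|T1|%:R :> R by [rewrite ler1n|]; lra.
have [k [j [pt [Nk ej sep emp]]]] :=
  muP U (1 - kap) (Num.truncn (2 * (ln 2 + D) / gam)) oU muU.
rewrite opprB addrCA subrr addr0 in emp.
have := markov_card k0 emp (ltn0Sn k).
set E := finset _ => jE.
set b := Num.truncn _ in E jE.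
have Kq : (k.+1 <= (k.+1 %/ q).+1 * q)%N by apply/ltnW/ltn_ceil.
have cE : (#|E| <= (2 * #|T1|) ^ (k.+1 %/ q).+1 * (2 * #|T2|) ^ b)%N.
  apply: (@card_separated M g (fun x y => (rdist A x y < delta%:E)%E) q T1 T2 U beta alpha
    q0 betaP alphaP k.+1 _ b _ E pt Kq).
  - by move=> s t _ _; exact: sep.
  - by move=> s; rewrite inE.
have jb : (j.+1 <= 2 * ((2 * #|T1|) ^ (k.+1 %/ q).+1 * (2 * #|T2|) ^ b))%N.
  by apply: (leq_trans jE); rewrite leq_mul2l.
have lnj := ln_card_bound R (ltn0Sn j) T10 T20 jb.
have cj : c * k.+1%:R < ln j.+1%:R.
  by rewrite -ltr_expR lnK ?posrE// ltr0n.
have x0' : 0 <= k.+1%:R :> R by [].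
apply: (@growth_numerics R c a H gam kap B D (ln 2) q%:R k.+1%:R) => //.
- exact: ltW.
- rewrite [leRHS]mulrC -ler_pdivrMr//; apply: (le_trans (ltW (truncnS_gt _))).
  by rewrite ler_nat ltnS.
apply: (lt_le_trans cj); apply: (le_trans lnj).
rewrite -/D -/B; apply: lerD.
  rewrite lerD2l -[leLHS]mulr_natr ler_wpM2l// -(natr1 (k.+1 %/ q)) lerD2r ler_pdivlMr//.
  by rewrite -natrM ler_nat leq_trunc_div.
rewrite -[leLHS]mulr_natr ler_wpM2l// truncn_le !mulr_ge0//; exact: ltW.
Qed.
End CoreInequality.

(** * Comparison of nearby maps *)

Section Transfer.
Context {R : realType} {M : ptopologicalType} {n : nat}.
Variable A : riemannianManifold R M n.
Implicit Types (x y z : M) (f g : M -> M).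
Local Open Scope ereal_scope.

(** The induction closes with the factor [L ^+ i - 1] because
    [L * (L ^+ i - 1) + 1 <= L ^+ i.+1 - 1] when [2 <= L]. *)
Lemma orbit_deviation f g (L eps : R) x i :
  C1_map A g -> (2 <= L)%R -> normD A g <= L%:E -> (0 <= eps)%R ->
  (forall y, rdist A (g y) (f y) <= eps%:E) ->
  rdist A (iter i g x) (iter i f x) <= ((L ^+ i - 1) * eps)%:E.
Proof.
move=> Cg L2 gL eps0 gf; elim: i => [|i IH]; first by rewrite rdist_refl subrr mul0r.
rewrite !iterS; apply: (le_trans (rdist_triangle A _ (g (iter i f x)) _)).
have L0 : (0 < L)%R by lra.
have step : rdist A (g (iter i g x)) (g (iter i f x)) <= (L * ((L ^+ i - 1) * eps))%:E.
  by apply: (le_trans (rdist_map _ _ Cg L0 gL)); rewrite EFinM lee_pmul2l ?lte_fin.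
apply: (le_trans (leeD step (gf _))); rewrite -EFinD lee_fin exprS.
have -> : (L * ((L ^+ i - 1) * eps) + eps = (L * L ^+ i - L + 1) * eps)%R by ring.
by apply: ler_wpM2r => //; lra.
Qed.

Lemma dyn_close_transfer f g (L eps eta : R) p x z :
  C1_map A g -> (2 <= L)%R -> normD A g <= L%:E -> (0 < eps)%R ->
  (forall y, rdist A (g y) (f y) <= eps%:E) ->
  (L ^+ p * eps <= eta / 4)%R ->
  dyn_close A p f (eta / 2) x z -> dyn_close A p g eta x z.
Proof.
move=> Cg L2 gL eps0 gf Leps fxz i ip.
have dev y : rdist A (iter i g y) (iter i f y) <= (eta / 4)%:E.
  apply: (le_trans (orbit_deviation y i Cg L2 gL (ltW eps0) gf)); rewrite lee_fin.
  apply: le_trans Leps; apply: ler_wpM2r; first exact: ltW.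
  have : (L ^+ i <= L ^+ p)%R by apply: ler_weXn2l; [lra|exact: ltnW].
  by lra.
apply: (le_lt_trans (rdist_triangle A _ (iter i f x) _)).
apply: (@le_lt_trans _ _ ((eta / 4)%:E + (rdist A (iter i f x) (iter i f z) + (eta / 4)%:E))).
  apply: leeD; first exact: dev.
  apply: (le_trans (rdist_triangle A _ (iter i f z) _)); rewrite leeD2l//.
  by rewrite rdist_sym.
have -> : eta%:E = (eta / 4)%:E + ((eta / 2)%:E + (eta / 4)%:E) :> \bar R.
  by rewrite -!EFinD; congr (_%:E); field.
by rewrite lteD2lE// lteD2rE// fxz.
Qed.

End Transfer.

Theorem proposition2p7 (R : realType) (M : ptopologicalType) (n : nat)
    (A : riemannianManifold R M n) (compactM : compact [set: M])
    (f : M -> M) (f_cont : continuous f)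
    (G : set (M -> M)) (G_C1 : forall g, G g -> C1_map A g)
    (hlocG_cvg0 : hlocG A G e @[e --> 0^'+] --> (0 : \bar R))
    (M0_fin : (M0 A G < +oo)%E) :
  forall (eps eta : R), 0 < eps -> is_N A f G eps eta ->
  forall g, G g -> (map_dist A g f <= eps%:E)%E ->
  (entropy A g <= entropy A f + 2%:E * hlocG A G eta)%E.
Proof.
move=> eps eta eps0 [[eta0 [p [[p0 pc] _] epsE]] _] g Gg gf.
have cg : continuous g by have [] := G_C1 g Gg.
have gG : (hloc A g eta <= hlocG A G eta)%E by apply: ereal_sup_ubound; exists g.
have hg0 := hloc_ge0 A compactM cg eta0.
have hG0 : (0 <= hlocG A G eta)%E by exact: le_trans hg0 gG.
have gM : (maxe (normD A g) 2%:E <= M0 A G)%E by apply: ereal_sup_ubound; exists g.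
have M2 : (2%:E <= M0 A G)%E by apply: le_trans gM; rewrite le_max lexx orbT.
have gL : (normD A g <= M0 A G)%E by apply: le_trans gM; rewrite le_max lexx.
have Mfin : M0 A G \is a fin_num.
  by rewrite ge0_fin_numE//; apply: le_trans M2.
set L := fine (M0 A G) in epsE.
have ML : M0 A G = L%:E by rewrite fineK.
rewrite ML lee_fin in M2; rewrite ML in gL.
have ent_f := entropy_at_le A f (divr_gt0 eta0 (ltr0n R 4)).
have ef0 := entropy_ge0 A f.
(* When the right-hand side is infinite it is [+oo], both terms being
   nonnegative; otherwise all quantities are finite. *)
have [-> | hGoo] := eqVneq (hlocG A G eta) +oo%E.
  by rewrite gt0_muley ?lte_fin// addey ?leey// gt_eqF// (lt_le_trans _ ef0).
have hGf : hlocG A G eta \is a fin_num by rewrite ge0_fin_numE// lt_neqAle hGoo leey.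
have [-> | efoo] := eqVneq (entropy A f) +oo%E.
  by rewrite addye ?leey// gt_eqF// (lt_le_trans _ (mule_ge0 _ hG0)).
have eff : entropy_at A f (eta / 4) \is a fin_num.
  rewrite ge0_fin_numE ?entropy_at_ge0//; apply: (le_lt_trans ent_f).
  by rewrite lt_neqAle efoo leey.
rewrite leeBlDr// in pc.
have rfin : (rspan A p f setT (eta / 4) < +oo)%E.
  rewrite ltey; apply/eqP => r_oo; move: pc.
  rewrite r_oo /= gt0_muley ?lte_fin ?invr_gt0 ?ltr0n// leye_eq => /eqP e.
  by have := fin_numD (hlocG A G eta) (entropy_at A f (eta / 4)); rewrite e hGf eff.
have [m [_ [rm _ _]]] := rspan_nat rfin.
have rle : (rspan A p f setT (eta / 4) <= m%:R%:E)%E by rewrite rm.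
have [m' [pt [m'm ptP]]] := rspan_code rle.
rewrite ler_nat in m'm.
have exi x : exists i : 'I_m, dyn_close A p f (eta / 4) x (pt i).
  by have [i im xi] := ptP x I; exists (Ordinal (leq_trans im m'm)).
have [code codeP] := choice exi.
have gfx y : (rdist A (g y) (f y) <= eps%:E)%E.
  by apply: le_trans gf; apply: ereal_sup_ubound; exists y.
have L0 : 0 < L by lra.
have Leps : L ^+ p * eps <= eta / 4.
  by rewrite -epsE mulrCA divff ?mulr1// gt_eqF// exprn_gt0.
have cells x z : code x = code z -> dyn_close A p g eta x z.
  move=> e; apply: (dyn_close_transfer (G_C1 g Gg) M2 gL eps0 gfx Leps).
  have -> : eta / 2 = eta / 4 + eta / 4 by field.
  apply: (dyn_close_trans (codeP x)); rewrite e; exact: dyn_close_sym.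
have m0 : (0 < m)%N by apply: leq_ltn_trans (ltn_ord (code point)).
apply: (le_trans (entropy_le_code_local compactM cg eta0 p0 cells)).
rewrite card_ord.
have -> : (p%:R^-1 * ln m%:R)%:E = ((p%:R^-1)%:E * lne (rspan A p f setT (eta / 4)))%E.
  by rewrite rm lne_EFin ?ltr0n.
apply: (le_trans (leeD pc gG)).
have -> : (2%:E * hlocG A G eta = hlocG A G eta + hlocG A G eta)%E.
  by rewrite -(fineK hGf) -EFinM -EFinD; congr (_%:E); ring.
by rewrite addeAC addeC leeD2r.
Qed.
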